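(* Let $n\ge 1$ and let $\Gamma$ be either $\Sigma_n$ or $\Pi_n$. There exist an infinite r.e. family $\{T_i\}_{i\in\omega}$ of theories and a theory $U$ satisfying the following two conditions: (1) for all $k\in\omega$, $\Bigl(\bigcap_{i\le k}\mathrm{Cons}(\Gamma,T_i)\Bigr)\setminus \mathrm{Th}(U)\ne\emptyset$; (2) $\Bigl(\bigcap_{i\in\omega}\mathrm{Cons}(\Gamma,T_i)\Bigr)\setminus \mathrm{Th}(U)=\emptyset$.
   Context: $\mathsf{PA}$ is Peano Arithmetic. A ''theory'' means a recursively enumerable (r.e.) consistent extension of $\mathsf{PA}$ in the language of $\mathsf{PA}$. An infinite r.e. family of theories $\{T_i\}_{i\in\omega}$ is a sequence of theories with $T_i$ uniformly r.e. in $i$. For $n\ge1$, $\Sigma_n$ and $\Pi_n$ are the usual classes of formulas of the arithmetical hierarchy (over bounded, i.e. $\Delta_0$, formulas), with closure properties used up to $\mathsf{PA}$-provable equivalence. Put $\Sigma_n^d=\Pi_n$ and $\Pi_n^d=\Sigma_n$. $\mathrm{Th}(U)$ is the set of all sentences provable in $U$. A sentence $\varphi$ is $\Gamma$-conservative over $T$ if for every $\Gamma$ sentence $\psi$, $T+\varphi\vdash\psi$ implies $T\vdash\psi$. $\mathrm{Cons}(\Gamma,T)$ is the set of all $\Gamma^d$ sentences that are $\Gamma$-conservative over $T$. *)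

(* Defs.v *)
From Stdlib Require Import Arith List Cantor.
Import ListNotations.

(** Variables are de Bruijn indices; the missing connectives are classical
    abbreviations. *)

Inductive term : Type :=
| Var (x : nat)
| Zero
| Succ (t : term)
| Plus (s t : term)
| Mult (s t : term).

Inductive form : Type :=
| Eq (s t : term)
| Bot
| Imp (A B : form)
| All (A : form).

Definition Neg (A : form) : form := Imp A Bot.
Definition And (A B : form) : form := Neg (Imp A (Neg B)).
Definition Iff (A B : form) : form := And (Imp A B) (Imp B A).
Definition Ex (A : form) : form := Neg (All (Neg A)).

Fixpoint tsubst (f : nat -> term) (t : term) : term :=
  match t with
  | Var x => f x
  | Zero => Zero
  | Succ t => Succ (tsubst f t)
  | Plus s t => Plus (tsubst f s) (tsubst f t)
  | Mult s t => Mult (tsubst f s) (tsubst f t)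
  end.

Definition tshift : term -> term := tsubst (fun x => Var (S x)).

Definition up (f : nat -> term) (x : nat) : term :=
  match x with 0 => Var 0 | S x => tshift (f x) end.

Fixpoint subst (f : nat -> term) (A : form) : form :=
  match A with
  | Eq s t => Eq (tsubst f s) (tsubst f t)
  | Bot => Bot
  | Imp A B => Imp (subst f A) (subst f B)
  | All A => All (subst (up f) A)
  end.

Definition shift : form -> form := subst (fun x => Var (S x)).

(** [inst t A] removes the outermost binder of [All A]. *)
Definition inst (t : term) : form -> form :=
  subst (fun x => match x with 0 => t | S x => Var x end).

Fixpoint tbounded (k : nat) (t : term) : Prop :=
  match t with
  | Var x => x < k
  | Zero => True
  | Succ t => tbounded k t
  | Plus s t | Mult s t => tbounded k s /\ tbounded k t
  end.

Fixpoint bounded (k : nat) (A : form) : Prop :=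
  match A with
  | Eq s t => tbounded k s /\ tbounded k t
  | Bot => True
  | Imp A B => bounded k A /\ bounded k B
  | All A => bounded (S k) A
  end.

Definition sentence (A : form) : Prop := bounded 0 A.

Inductive nd : list form -> form -> Prop :=
| nd_hyp L A : In A L -> nd L A
| nd_impI L A B : nd (A :: L) B -> nd L (Imp A B)
| nd_impE L A B : nd L (Imp A B) -> nd L A -> nd L B
| nd_raa L A : nd (Neg A :: L) Bot -> nd L A
| nd_allI L A : nd (map shift L) A -> nd L (All A)
| nd_allE L A t : nd L (All A) -> nd L (inst t A)
| nd_refl L t : nd L (Eq t t)
| nd_leibniz L A s t : nd L (Eq s t) -> nd L (inst s A) -> nd L (inst t A).

Definition proves (T : form -> Prop) (A : form) : Prop :=
  exists L, (forall B, In B L -> T B) /\ nd L A.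

Definition add_axiom (T : form -> Prop) (A : form) : form -> Prop :=
  fun B => T B \/ B = A.

Definition induction (A : form) : form :=
  Imp (inst Zero A)
    (Imp (All (Imp A (subst (fun x => match x with
                                      | 0 => Succ (Var 0)
                                      | S x => Var (S x)
                                      end) A)))
       (All A)).

(** Induction is taken for formulas with parameters: the axioms are the
    universal closures of the instances. *)
Inductive PA : form -> Prop :=
| PA_succ_nonzero : PA (All (Neg (Eq (Succ (Var 0)) Zero)))
| PA_succ_inj :
    PA (All (All (Imp (Eq (Succ (Var 0)) (Succ (Var 1))) (Eq (Var 0) (Var 1)))))
| PA_plus_zero : PA (All (Eq (Plus (Var 0) Zero) (Var 0)))
| PA_plus_succ :
    PA (All (All (Eq (Plus (Var 0) (Succ (Var 1))) (Succ (Plus (Var 0) (Var 1))))))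
| PA_mult_zero : PA (All (Eq (Mult (Var 0) Zero) Zero))
| PA_mult_succ :
    PA (All (All (Eq (Mult (Var 0) (Succ (Var 1)))
                     (Plus (Mult (Var 0) (Var 1)) (Var 0)))))
| PA_induction A m :
    sentence (Nat.iter m All (induction A)) ->
    PA (Nat.iter m All (induction A)).

Definition Le (s t : term) : form :=
  Ex (Eq (Plus (Var 0) (tshift s)) (tshift t)).

(** The bound [t] lives outside the binder, so the bound variable cannot occur
    in it. *)
Definition BAll (t : term) (A : form) : form := All (Imp (Le (Var 0) (tshift t)) A).
Definition BEx (t : term) (A : form) : form := Ex (And (Le (Var 0) (tshift t)) A).

Inductive Delta0 : form -> Prop :=
| Delta0_eq s t : Delta0 (Eq s t)
| Delta0_bot : Delta0 Bot
| Delta0_imp A B : Delta0 A -> Delta0 B -> Delta0 (Imp A B)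
| Delta0_ball t A : Delta0 A -> Delta0 (BAll t A)
| Delta0_bex t A : Delta0 A -> Delta0 (BEx t A).

Inductive side : Type := Sigma | Pi.

Definition dual (G : side) : side :=
  match G with Sigma => Pi | Pi => Sigma end.

(** Prenex formulas: a (possibly empty) block of like quantifiers in front of a
    formula of the dual class one level below. *)
Inductive prenex : side -> nat -> form -> Prop :=
| prenex_Delta0 G A : Delta0 A -> prenex G 0 A
| prenex_dual G n A : prenex (dual G) n A -> prenex G (S n) A
| prenex_ex n A : prenex Sigma (S n) A -> prenex Sigma (S n) (Ex A)
| prenex_all n A : prenex Pi (S n) A -> prenex Pi (S n) (All A).

(** Sigma_n and Pi_n are read as closed under PA-provable equivalence, so that
    they have the usual closure properties. *)
Definition in_class (G : side) (n : nat) (A : form) : Prop :=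
  exists B, prenex G n B /\ proves PA (Iff A B).

(** Codes are not indexed by arity: missing arguments of [RSucc] and [RProj]
    read as 0, and [RRec] is undefined on the empty list. *)
Inductive rec : Type :=
| RZero
| RSucc
| RProj (i : nat)
| RComp (f : rec) (gs : list rec)
| RRec (f g : rec)
| RMu (f : rec).

Inductive eval : rec -> list nat -> nat -> Prop :=
| eval_zero xs : eval RZero xs 0
| eval_succ xs : eval RSucc xs (S (nth 0 xs 0))
| eval_proj i xs : eval (RProj i) xs (nth i xs 0)
| eval_comp f gs xs ys z :
    Forall2 (fun g y => eval g xs y) gs ys -> eval f ys z ->
    eval (RComp f gs) xs z
| eval_rec0 f g xs y : eval f xs y -> eval (RRec f g) (0 :: xs) y
| eval_recS f g n xs r y :
    eval (RRec f g) (n :: xs) r -> eval g (n :: r :: xs) y ->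
    eval (RRec f g) (S n :: xs) y
| eval_mu f xs y :
    eval f (y :: xs) 0 ->
    (forall z, z < y -> exists v, eval f (z :: xs) (S v)) ->
    eval (RMu f) xs y.

Definition re_set (P : nat -> Prop) : Prop :=
  exists f, forall x, P x <-> exists y, eval f [x] y.

Definition uniformly_re (P : nat -> nat -> Prop) : Prop :=
  exists f, forall i x, P i x <-> exists y, eval f [i; x] y.

Fixpoint tcode (t : term) : nat :=
  match t with
  | Var x => to_nat (0, x)
  | Zero => to_nat (1, 0)
  | Succ t => to_nat (2, tcode t)
  | Plus s t => to_nat (3, to_nat (tcode s, tcode t))
  | Mult s t => to_nat (4, to_nat (tcode s, tcode t))
  end.

Fixpoint code (A : form) : nat :=
  match A with
  | Eq s t => to_nat (0, to_nat (tcode s, tcode t))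
  | Bot => to_nat (1, 0)
  | Imp A B => to_nat (2, to_nat (code A, code B))
  | All A => to_nat (3, code A)
  end.

Definition codes (T : form -> Prop) (x : nat) : Prop :=
  exists A, T A /\ code A = x.

(** A theory is given by its set of axioms, which need not be deductively
    closed. *)
Definition theory (T : form -> Prop) : Prop :=
  (forall A, T A -> sentence A) /\
  re_set (codes T) /\
  (forall A, proves PA A -> proves T A) /\
  ~ proves T Bot.

Definition re_family (T : nat -> form -> Prop) : Prop :=
  (forall i, theory (T i)) /\ uniformly_re (fun i => codes (T i)).

Definition Th (U : form -> Prop) (A : form) : Prop :=
  sentence A /\ proves U A.

Definition conservative (G : side) (n : nat) (T : form -> Prop) (A : form) : Prop :=
  forall B, sentence B -> in_class G n B ->
    proves (add_axiom T A) B -> proves T B.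

Definition Cons (G : side) (n : nat) (T : form -> Prop) (A : form) : Prop :=
  sentence A /\ in_class (dual G) n A /\ conservative G n T A.

(* Main.v *)
Require Import Defs.
From Stdlib Require Import Arith List Cantor Lia.
From Stdlib Require Import Classical FunctionalExtensionality PropExtensionality.
Import ListNotations.

(** Write [D] for the dual of [G]. The theorem follows from a recursive sequence
    of [D]-sentences [X 0], [X 1], ... such that every theory
    [all_but k] = PA + { X l : l <> k } + ~ X k is consistent
    ([independent_claims]).

    Let [U] be PA with the axioms ~ X p -> X q for p <> q ([almost_all]), so that
    at most one [X l] fails in a model of [U]. Each [all_but k] proves the axioms
    of [U] and refutes [X k], hence [U] does not prove [X k]. Let [T j]
    ([refuting j]) be [U] together with all [X l], l >= j + 2, and, if [j] codes a
    sentence [A], a bit [b] and some padding, the axiom A -> ~ X b. Then [T j] is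
    consistent, being provable in [all_but b].

    - [X (k + 2)] is an axiom of [T 0], ..., [T k], hence trivially conservative
      over each of them, and [U] does not prove it.
    - Let [A] be conservative over all [T j]. As [T j] + [A] proves the
      [G]-sentence ~ X b, so does [T j]; thus [U] + { X l : l >= j } + ~ A refutes
      both [X 0] and [X 1], of which [U] makes one true. Therefore [U] with any
      final segment of the [X l] proves [A]. In a model of [U] some final segment
      of the sequence holds, so [U] proves [A]; [almost_all_limit] is the
      syntactic form of this argument.

    The sequence [X] comes from self-reference. Let a search run through all
    proofs of a contradiction from one of the theories [all_but k], and call the
    first [k] for which it succeeds the selected value. If [D] is Pi, then [X l]
    says that [l] is not the selected value; if [D] is Sigma, it says that a value
    other than [l] is selected. Suppose that some [all_but k] is inconsistent and
    let [l] be the selected value. In both cases [X l] is the only sentence of the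
    sequence that is false in the standard model. So the standard model satisfies
    [all_but l], which is nevertheless inconsistent.

    This argument evaluates sentences in the standard model only and formalizes
    nothing inside PA. It does require that provability be definable there by a
    Delta_0 formula with one existential quantifier in front, and that such
    predicates be recursively enumerable. Definability is treated
    semantically ([Def1]), by closure properties of predicates on environments;
    the essential one is closure under inductive definitions ([def1_closure]),
    from which substitution, the axioms and provability are obtained. A Delta_0
    formula is compiled to a recursive function ([Delta0_computable]). *)

(** * Truth in the standard model *)

Definition scons (x : nat) (r : nat -> nat) (i : nat) : nat :=
  match i with 0 => x | S i => r i end.
Definition tail (r : nat -> nat) (i : nat) : nat := r (S i).

Fixpoint ev (r : nat -> nat) (t : term) : nat :=
  match t with
  | Var x => r x
  | Zero => 0
  | Succ t => S (ev r t)
  | Plus s t => ev r s + ev r t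
  | Mult s t => ev r s * ev r t
  end.

Fixpoint sat (r : nat -> nat) (A : form) : Prop :=
  match A with
  | Eq s t => ev r s = ev r t
  | Bot => False
  | Imp A B => sat r A -> sat r B
  | All A => forall x, sat (scons x r) A
  end.

Lemma scons_tail r : scons (r 0) (tail r) = r.
Proof. extensionality i. now destruct i. Qed.

Lemma ev_tsubst r f t : ev r (tsubst f t) = ev (fun x => ev r (f x)) t.
Proof. induction t; simpl; congruence. Qed.

Lemma ev_tshift x r t : ev (scons x r) (tshift t) = ev r t.
Proof. unfold tshift. rewrite ev_tsubst. reflexivity. Qed.

Lemma sat_subst A : forall r f, sat r (subst f A) <-> sat (fun x => ev r (f x)) A.
Proof.
  induction A as [s t| |A IHA B IHB|A IH]; intros r f; simpl.
  - now rewrite !ev_tsubst.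
  - tauto.
  - now rewrite IHA, IHB.
  - assert (E : forall x, (fun y => ev (scons x r) (up f y)) =
                          scons x (fun y => ev r (f y))).
    { intros x. extensionality y. destruct y; simpl; auto using ev_tshift. }
    split; intros H x; specialize (H x).
    + rewrite IH, E in H. exact H.
    + rewrite IH, E. exact H.
Qed.

Lemma sat_inst r t A : sat r (inst t A) <-> sat (scons (ev r t) r) A.
Proof.
  unfold inst. rewrite sat_subst.
  replace (fun x => ev r match x with 0 => t | S x => Var x end)
    with (scons (ev r t) r); [tauto|].
  extensionality i. now destruct i.
Qed.

Lemma sat_shift x r A : sat (scons x r) (shift A) <-> sat r A.
Proof. unfold shift. now rewrite sat_subst. Qed.

Lemma sat_neg r A : sat r (Neg A) <-> ~ sat r A.
Proof. reflexivity. Qed.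

Lemma sat_and r A B : sat r (And A B) <-> sat r A /\ sat r B.
Proof. simpl. tauto. Qed.

Lemma sat_ex r A : sat r (Ex A) <-> exists x, sat (scons x r) A.
Proof.
  simpl. split.
  - intros H. apply NNPP. intros N. apply H. intros x Hx. eauto.
  - intros [x Hx] H. exact (H x Hx).
Qed.

Lemma sat_le r s t : sat r (Le s t) <-> ev r s <= ev r t.
Proof.
  unfold Le. rewrite sat_ex. simpl. split.
  - intros [x H]. rewrite !ev_tshift in H. lia.
  - intros H. exists (ev r t - ev r s). rewrite !ev_tshift. lia.
Qed.

Lemma sat_ball r t A :
  sat r (BAll t A) <-> forall x, x <= ev r t -> sat (scons x r) A.
Proof.
  unfold BAll. cbn [sat].
  split; intros H x; specialize (H x); rewrite sat_le, ev_tshift in *; exact H.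
Qed.

Lemma sat_bex r t A :
  sat r (BEx t A) <-> exists x, x <= ev r t /\ sat (scons x r) A.
Proof.
  unfold BEx. rewrite sat_ex.
  split; intros [x H]; exists x; rewrite sat_and, sat_le, ev_tshift in *; exact H.
Qed.

Lemma sat_PA A r : PA A -> sat r A.
Proof.
  intros H; revert r; destruct H; intros r; simpl; try (intros; lia).
  clear H. revert r.
  assert (H : forall r, sat r (induction A)).
  { intros r. unfold induction. cbn [sat]. rewrite sat_inst. intros H0 HS x.
    induction x as [|x IH]; [exact H0|].
    specialize (HS x IH). rewrite sat_subst in HS.
    replace (scons (S x) r) with
      (fun y => ev (scons x r) match y with 0 => Succ (Var 0) | S z => Var (S z) end);
      [exact HS|].
    extensionality y. now destruct y. }
  induction m as [|m IH]; simpl; [exact H|]. intros r x. apply IH.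
Qed.

(** * A Hilbert calculus *)

(** Provability without contexts is easier to code by numbers than [nd]. Only one
    inclusion between the two calculi is proved: soundness in the standard model
    bounds [hilbert] from above. *)
Inductive logical : form -> Prop :=
| log_K A B : logical (Imp A (Imp B A))
| log_S A B C :
    logical (Imp (Imp A (Imp B C)) (Imp (Imp A B) (Imp A C)))
| log_dn A : logical (Imp (Neg (Neg A)) A)
| log_dist A B : logical (Imp (All (Imp A B)) (Imp (All A) (All B)))
| log_vac A : logical (Imp A (All (shift A)))
| log_inst A t : logical (Imp (All A) (inst t A))
| log_refl t : logical (Eq t t)
| log_leib A s t : logical (Imp (Eq s t) (Imp (inst s A) (inst t A))).

Inductive hilbert (T : form -> Prop) : form -> Prop :=
| hil_ax A : T A -> hilbert T A
| hil_log A : logical A -> hilbert T A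
| hil_mp A B : hilbert T (Imp A B) -> hilbert T A -> hilbert T B
| hil_gen A : hilbert T A -> hilbert T (All A).

Lemma sat_logical A r : logical A -> sat r A.
Proof.
  destruct 1 as [A B|A B C|A|A B|A|A t|t|A s t]; cbn [sat Neg].
  - tauto.
  - tauto.
  - apply NNPP.
  - intros H1 H2 x. exact (H1 x (H2 x)).
  - intros H x. now rewrite sat_shift.
  - intros H. rewrite sat_inst. apply H.
  - reflexivity.
  - rewrite !sat_inst. now intros ->.
Qed.

Lemma sat_hilbert T A :
  (forall B r, T B -> sat r B) -> hilbert T A -> forall r, sat r A.
Proof.
  intros HT. induction 1 as [A HA|A HA|A B _ IH1 _ IH2|A _ IH]; intros r; auto.
  - now apply sat_logical.
  - exact (IH1 r (IH2 r)).
  - intros x. apply IH.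
Qed.

(** The head of the list becomes the innermost antecedent, so that discharging it
    is a conversion. *)
Fixpoint imps (L : list form) (A : form) : form :=
  match L with [] => A | B :: L => imps L (Imp B A) end.

Section Deduction.
Context (T : form -> Prop).

Lemma hil_weaken L A : hilbert T A -> hilbert T (imps L A).
Proof.
  revert A; induction L as [|B L IH]; intros A H; simpl; auto.
  apply IH. eapply hil_mp; [|exact H]. apply hil_log, log_K.
Qed.

Lemma hil_imps_mp L A B :
  hilbert T (imps L (Imp A B)) -> hilbert T (imps L A) -> hilbert T (imps L B).
Proof.
  revert A B; induction L as [|C L IH]; intros A B H1 H2; simpl in *.
  - eapply hil_mp; eauto.
  - eapply IH; [|exact H2]. eapply IH; [|exact H1].
    apply hil_weaken, hil_log, log_S.
Qed.

Lemma hil_hyp L A : In A L -> hilbert T (imps L A).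
Proof.
  revert A; induction L as [|B L IH]; intros A; simpl; [tauto|].
  intros [->|H].
  - apply hil_weaken.
    apply (hil_mp _ (Imp A (Imp A A))); [|apply hil_log, log_K].
    apply (hil_mp _ (Imp A (Imp (Imp A A) A))); [apply hil_log, log_S|].
    apply hil_log, log_K.
  - eapply hil_imps_mp; [|exact (IH A H)]. apply hil_weaken, hil_log, log_K.
Qed.

(** Generalization moves outwards past the hypotheses one by one: [B] yields
    [All (shift B)], which distribution feeds to the generalized implication. *)
Lemma hil_allI L A :
  hilbert T (imps (map shift L) A) -> hilbert T (imps L (All A)).
Proof.
  revert A; induction L as [|B L IH]; intros A H; simpl in *.
  - now apply hil_gen.
  - apply IH in H.
    assert (H1 : hilbert T (imps L (Imp (All (shift B)) (All A)))).
    { eapply hil_imps_mp; [|exact H]. apply hil_weaken, hil_log, log_dist. }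
    set (V := All (shift B)) in *.
    (* Composition of [B -> V] and [V -> All A]. *)
    apply (hil_imps_mp _ (Imp B V)); [|apply hil_weaken, hil_log, log_vac].
    eapply hil_imps_mp; [apply hil_weaken, hil_log, log_S|].
    eapply hil_imps_mp; [|exact H1]. apply hil_weaken, hil_log, log_K.
Qed.

Lemma nd_hilbert L A : nd L A -> hilbert T (imps L A).
Proof.
  induction 1 as [L A H|L A B _ IH|L A B _ IH1 _ IH2|L A _ IH|L A _ IH
                 |L A t _ IH|L t|L A s t _ IH1 _ IH2].
  - now apply hil_hyp.
  - exact IH.
  - eapply hil_imps_mp; eauto.
  - eapply hil_imps_mp; [|exact IH]. apply hil_weaken, hil_log, log_dn.
  - now apply hil_allI.
  - eapply hil_imps_mp; [|exact IH]. apply hil_weaken, hil_log, log_inst.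
  - apply hil_weaken, hil_log, log_refl.
  - eapply hil_imps_mp; [|exact IH2]. eapply hil_imps_mp; [|exact IH1].
    apply hil_weaken, hil_log, log_leib.
Qed.

Lemma proves_hilbert A : proves T A -> hilbert T A.
Proof.
  intros (L & HL & H). apply nd_hilbert in H. revert A H.
  induction L as [|B L IH]; intros A H; simpl in *; [exact H|].
  apply (hil_mp _ B); [|apply hil_ax, HL; auto].
  apply IH; auto.
Qed.

End Deduction.

(** * Predicates definable in the standard model *)

Lemma tsubst_comp f g t :
  tsubst g (tsubst f t) = tsubst (fun x => tsubst g (f x)) t.
Proof. induction t; simpl; congruence. Qed.

Lemma tsubst_up_tshift f t : tsubst (up f) (tshift t) = tshift (tsubst f t).
Proof. unfold tshift. now rewrite !tsubst_comp. Qed.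

Lemma subst_Le f s t : subst f (Le s t) = Le (tsubst f s) (tsubst f t).
Proof. unfold Le, Ex, Neg. cbn [subst tsubst]. now rewrite !tsubst_up_tshift. Qed.

Lemma subst_BAll f t A : subst f (BAll t A) = BAll (tsubst f t) (subst (up f) A).
Proof.
  unfold BAll. cbn [subst]. rewrite subst_Le, tsubst_up_tshift. reflexivity.
Qed.

Lemma subst_BEx f t A : subst f (BEx t A) = BEx (tsubst f t) (subst (up f) A).
Proof.
  unfold BEx, Ex, And, Neg. cbn [subst]. rewrite subst_Le, tsubst_up_tshift.
  reflexivity.
Qed.

Lemma Delta0_subst A : Delta0 A -> forall f, Delta0 (subst f A).
Proof.
  induction 1 as [s t| |A B _ IHA _ IHB|t A _ IH|t A _ IH]; intros f.
  - apply Delta0_eq.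
  - apply Delta0_bot.
  - apply (Delta0_imp _ _ (IHA f) (IHB f)).
  - rewrite subst_BAll. apply Delta0_ball, IH.
  - rewrite subst_BEx. apply Delta0_bex, IH.
Qed.

(** The functions that may occur in atomic formulas and as bounds of quantifiers. *)
Definition polynomial (f : (nat -> nat) -> nat) : Prop :=
  exists t, forall r, ev r t = f r.

Lemma poly_var i : polynomial (fun r => r i).
Proof. now exists (Var i). Qed.

Fixpoint num (n : nat) : term :=
  match n with 0 => Zero | S n => Succ (num n) end.

Lemma ev_num r n : ev r (num n) = n.
Proof. induction n; simpl; congruence. Qed.

Lemma poly_const n : polynomial (fun _ => n).
Proof. exists (num n). intros r. apply ev_num. Qed.

Lemma poly_succ f : polynomial f -> polynomial (fun r => S (f r)).
Proof. intros [t H]. exists (Succ t). intros r. simpl. now rewrite H. Qed.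

Lemma poly_plus f g :
  polynomial f -> polynomial g -> polynomial (fun r => f r + g r).
Proof. intros [s H] [t K]. exists (Plus s t). intros r. simpl. now rewrite H, K. Qed.

Lemma poly_mult f g :
  polynomial f -> polynomial g -> polynomial (fun r => f r * g r).
Proof. intros [s H] [t K]. exists (Mult s t). intros r. simpl. now rewrite H, K. Qed.

Definition Def0 (P : (nat -> nat) -> Prop) : Prop :=
  exists A, Delta0 A /\ forall r, sat r A <-> P r.

Lemma def0_ext (P Q : (nat -> nat) -> Prop) :
  Def0 P -> (forall r, P r <-> Q r) -> Def0 Q.
Proof.
  intros (A & HA & H) E. exists A. split; [exact HA|].
  intros r. rewrite H. apply E.
Qed.

Lemma def0_ren P (xi : nat -> nat) : Def0 P -> Def0 (fun r => P (fun i => r (xi i))).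
Proof.
  intros (A & HA & H). exists (subst (fun i => Var (xi i)) A).
  split; [now apply Delta0_subst|]. intros r. rewrite sat_subst. apply H.
Qed.

Lemma def0_eq f g : polynomial f -> polynomial g -> Def0 (fun r => f r = g r).
Proof.
  intros [s Hs] [t Ht]. exists (Eq s t). split; [constructor|].
  intros r. simpl. now rewrite Hs, Ht.
Qed.

Lemma def0_imp P Q : Def0 P -> Def0 Q -> Def0 (fun r => P r -> Q r).
Proof.
  intros (A & HA & H) (B & HB & K). exists (Imp A B). split; [now constructor|].
  intros r. simpl. now rewrite H, K.
Qed.

Lemma def0_not P : Def0 P -> Def0 (fun r => ~ P r).
Proof.
  intros H. apply (def0_imp _ (fun _ => False) H). exists Bot.
  split; [constructor|]. reflexivity.
Qed.

Lemma def0_and P Q : Def0 P -> Def0 Q -> Def0 (fun r => P r /\ Q r).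
Proof.
  intros H K. eapply def0_ext; [exact (def0_not _ (def0_imp _ _ H (def0_not _ K)))|].
  intros r. simpl. tauto.
Qed.

Lemma def0_or P Q : Def0 P -> Def0 Q -> Def0 (fun r => P r \/ Q r).
Proof.
  intros H K. eapply def0_ext; [exact (def0_imp _ _ (def0_not _ H) K)|].
  intros r. simpl. destruct (classic (P r)); tauto.
Qed.

Lemma def0_ball f (Q : (nat -> nat) -> nat -> Prop) :
  polynomial f -> Def0 (fun r => Q (tail r) (r 0)) ->
  Def0 (fun r => forall x, x <= f r -> Q r x).
Proof.
  intros [t Ht] (A & HA & H). exists (BAll t A). split; [now constructor|].
  intros r. rewrite sat_ball, Ht.
  split; intros K x Hx; [apply (H (scons x r))|apply H]; now apply K.
Qed.

Lemma def0_bex f (Q : (nat -> nat) -> nat -> Prop) :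
  polynomial f -> Def0 (fun r => Q (tail r) (r 0)) ->
  Def0 (fun r => exists x, x <= f r /\ Q r x).
Proof.
  intros [t Ht] (A & HA & H). exists (BEx t A). split; [now constructor|].
  intros r. rewrite sat_bex, Ht.
  split; intros (x & Hx & K); exists x; (split; [exact Hx|]);
    [apply (H (scons x r))|apply H]; exact K.
Qed.

Lemma def0_le f g : polynomial f -> polynomial g -> Def0 (fun r => f r <= g r).
Proof.
  intros [s Hs] Hg.
  eapply (def0_ext (fun r => exists x, x <= g r /\ x = f r)).
  - apply (def0_bex g (fun r x => x = f r) Hg).
    apply def0_eq; [apply poly_var|]. exists (tshift s). intros r.
    rewrite <- (Hs (tail r)), <- (scons_tail r) at 1. apply ev_tshift.
  - intros r. split; [now intros (x & Hx & ->)|eauto].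
Qed.

Definition Def1 (P : (nat -> nat) -> Prop) : Prop :=
  exists R, Def0 R /\ forall r, P r <-> exists w, R (scons w r).

Lemma def1_ext (P Q : (nat -> nat) -> Prop) :
  Def1 P -> (forall r, P r <-> Q r) -> Def1 Q.
Proof.
  intros (R & HR & H) E. exists R. split; [exact HR|].
  intros r. rewrite <- H. symmetry. apply E.
Qed.

Lemma def1_D0 P : Def0 P -> Def1 P.
Proof.
  intros H. exists (fun r => P (tail r)). split; [exact (def0_ren P S H)|].
  intros r. split; [intros K; exists 0; exact K|intros [w K]; exact K].
Qed.

Lemma def1_ren P (xi : nat -> nat) : Def1 P -> Def1 (fun r => P (fun i => r (xi i))).
Proof.
  intros (R & HR & H).
  exists (fun r => R (scons (r 0) (fun i => r (S (xi i))))). split.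
  - eapply def0_ext;
      [apply (def0_ren _ (fun i => match i with 0 => 0 | S i => S (xi i) end) HR)|].
    intros r. simpl.
    replace (fun i => r match i with 0 => 0 | S i0 => S (xi i0) end)
      with (scons (r 0) (fun i => r (S (xi i)))); [tauto|].
    extensionality i. now destruct i.
  - intros r. apply H.
Qed.

(** Two witnesses are merged into a common bound for both. *)
Lemma def1_ex (Q : (nat -> nat) -> nat -> Prop) :
  Def1 (fun r => Q (tail r) (r 0)) -> Def1 (fun r => exists x, Q r x).
Proof.
  intros (R & HR & H).
  exists (fun r => exists x, x <= r 0 /\ exists w, w <= r 0 /\
            R (scons w (scons x (tail r)))). split.
  - apply (def0_bex (fun r => r 0)
      (fun r x => exists w, w <= r 0 /\ R (scons w (scons x (tail r)))));
      [apply poly_var|].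
    apply (def0_bex (fun r => tail r 0)
      (fun r w => R (scons w (scons (r 0) (tail (tail r)))))); [apply poly_var|].
    eapply def0_ext;
      [apply (def0_ren _ (fun i => match i with
                                 | 0 => 0 | 1 => 1 | S (S i) => S (S (S i)) end) HR)|].
    intros r. simpl.
    match goal with |- R ?a <-> R ?b => replace a with b; [tauto|] end.
    extensionality i. now destruct i as [|[|i]].
  - intros r. split.
    + intros [x Hx]. pose proof (proj1 (H (scons x r)) Hx) as [w Hw].
      exists (x + w). exists x. split; [simpl; lia|].
      exists w. split; [simpl; lia|]. exact Hw.
    + intros (v & x & _ & w & _ & Hw). exists x.
      apply (H (scons x r)). eauto.
Qed.

Lemma def1_and P Q : Def1 P -> Def1 Q -> Def1 (fun r => P r /\ Q r).
Proof.
  intros (R & HR & H) (R' & HR' & H').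
  apply (def1_ext (fun r => exists w, exists w', R (scons w r) /\ R' (scons w' r))).
  - apply def1_ex. apply (def1_ex (fun r w' => R (scons (r 0) (tail r)) /\ R' (scons w' (tail r)))).
    apply def1_D0, def0_and.
    + eapply def0_ext; [apply (def0_ren _ S HR)|]. intros r. simpl.
      match goal with |- R ?a <-> R ?b => replace a with b; [tauto|] end.
      extensionality i. now destruct i.
    + eapply def0_ext;
      [apply (def0_ren _ (fun i => match i with 0 => 0 | S i => S (S i) end) HR')|].
      intros r. simpl.
      match goal with |- R' ?a <-> R' ?b => replace a with b; [tauto|] end.
      extensionality i. now destruct i.
  - intros r. rewrite H, H'. split.
    + intros (w & w' & K & K'). eauto.
    + intros [[w K] [w' K']]. eauto.
Qed.

Lemma def1_or P Q : Def1 P -> Def1 Q -> Def1 (fun r => P r \/ Q r).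
Proof.
  intros (R & HR & H) (R' & HR' & H').
  exists (fun r => R r \/ R' r). split; [now apply def0_or|].
  intros r. rewrite H, H'. split.
  - intros [[w K]|[w K]]; eauto.
  - intros (w & [K|K]); eauto.
Qed.

(** In the standard model this is what moves a bounded universal quantifier past
    the witness of a [Def1] predicate. *)
Lemma collection n (R : nat -> nat -> Prop) :
  (forall x, x <= n -> exists w, R x w) ->
  exists v, forall x, x <= n -> exists w, w <= v /\ R x w.
Proof.
  induction n as [|n IH]; intros H.
  - destruct (H 0 (le_n 0)) as [w Hw]. exists w. intros x Hx.
    replace x with 0 by lia. eauto.
  - destruct IH as [v Hv]; [intros x Hx; apply H; lia|].
    destruct (H (S n) (le_n _)) as [w Hw].
    exists (v + w). intros x Hx. destruct (Nat.eq_dec x (S n)) as [->|Hn].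
    + exists w. split; [lia|exact Hw].
    + destruct (Hv x) as (u & Hu & Ru); [lia|]. exists u. split; [lia|exact Ru].
Qed.

Lemma def1_ball i (Q : (nat -> nat) -> nat -> Prop) :
  Def1 (fun r => Q (tail r) (r 0)) -> Def1 (fun r => forall x, x <= r i -> Q r x).
Proof.
  intros (R & HR & H).
  exists (fun r => forall x, x <= r (S i) -> exists w, w <= r 0 /\
            R (scons w (scons x (tail r)))). split.
  - apply (def0_ball (fun r => r (S i))
      (fun r x => exists w, w <= r 0 /\ R (scons w (scons x (tail r)))));
      [apply poly_var|].
    apply (def0_bex (fun r => tail r 0)
      (fun r w => R (scons w (scons (r 0) (tail (tail r)))))); [apply poly_var|].
    eapply def0_ext;
      [apply (def0_ren _ (fun i => match i with
                                 | 0 => 0 | 1 => 1 | S (S i) => S (S (S i)) end) HR)|].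
    intros r. simpl.
    match goal with |- R ?a <-> R ?b => replace a with b; [tauto|] end.
    extensionality j. now destruct j as [|[|j]].
  - intros r. split.
    + intros K. apply (collection (r i) (fun x w => R (scons w (scons x r)))).
      intros x Hx. apply (H (scons x r)). exact (K x Hx).
    + intros (v & K) x Hx. destruct (K x Hx) as (w & _ & Hw).
      apply (H (scons x r)). eauto.
Qed.

(** A function is treated through its graph, which makes it total recursive. *)
Definition Fun1 (f : (nat -> nat) -> nat) : Prop := Def1 (fun r => r 0 = f (tail r)).

Lemma fun1_poly f : polynomial f -> Fun1 f.
Proof.
  intros [t Ht]. apply def1_D0, def0_eq; [apply poly_var|].
  exists (tshift t). intros r. rewrite <- Ht, <- (scons_tail r) at 1.
  apply ev_tshift.
Qed.

Lemma fun1_ren f (xi : nat -> nat) : Fun1 f -> Fun1 (fun r => f (fun i => r (xi i))).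
Proof.
  intros H.
  exact (def1_ren _ (fun i => match i with 0 => 0 | S i => S (xi i) end) H).
Qed.

(** The graph of [f] defines the intermediate value, which is then quantified
    away. *)
Lemma def1_let (Q : (nat -> nat) -> nat -> Prop) f :
  Def1 (fun r => Q (tail r) (r 0)) -> Fun1 f -> Def1 (fun r => Q r (f r)).
Proof.
  intros HQ Hf. apply (def1_ext (fun r => exists y, y = f r /\ Q r y)).
  - apply def1_ex. now apply def1_and.
  - intros r. split; [now intros (y & -> & H)|eauto].
Qed.

Lemma def1_rel1 (P : nat -> Prop) f :
  Def1 (fun r => P (r 0)) -> Fun1 f -> Def1 (fun r => P (f r)).
Proof. intros H. now apply (def1_let (fun _ => P)). Qed.

Lemma def1_rel2 (P : nat -> nat -> Prop) f g :
  Def1 (fun r => P (r 0) (r 1)) -> Fun1 f -> Fun1 g -> Def1 (fun r => P (f r) (g r)).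
Proof.
  intros H Hf Hg. apply (def1_let (fun r x => P x (g r))); [|exact Hf].
  apply (def1_let (fun r x => P (r 0) x)); [|exact (fun1_ren g S Hg)].
  exact (def1_ren _ (fun i => match i with 0 => 1 | _ => 0 end) H).
Qed.

Lemma def1_rel3 (P : nat -> nat -> nat -> Prop) f g h :
  Def1 (fun r => P (r 0) (r 1) (r 2)) -> Fun1 f -> Fun1 g -> Fun1 h ->
  Def1 (fun r => P (f r) (g r) (h r)).
Proof.
  intros H Hf Hg Hh. apply (def1_let (fun r x => P (f r) (g r) x)); [|exact Hh].
  apply (def1_let (fun r x => P (f (tail r)) x (r 0))); [|exact (fun1_ren g S Hg)].
  apply (def1_let (fun r x => P x (r 0) (r 1))); [|exact (fun1_ren f (fun i => S (S i)) Hf)].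
  exact H.
Qed.

Lemma fun1_comp1 (F : nat -> nat) f :
  Fun1 (fun r => F (r 0)) -> Fun1 f -> Fun1 (fun r => F (f r)).
Proof.
  intros H Hf. apply (def1_let (fun r x => r 0 = F x)).
  - exact (def1_ren _ (fun i => match i with 0 => 1 | _ => 0 end) H).
  - exact (fun1_ren f S Hf).
Qed.

Lemma fun1_comp2 (F : nat -> nat -> nat) f g :
  Fun1 (fun r => F (r 0) (r 1)) -> Fun1 f -> Fun1 g -> Fun1 (fun r => F (f r) (g r)).
Proof.
  intros H Hf Hg. apply (def1_let (fun r x => r 0 = F (f (tail r)) x)).
  - apply (def1_let (fun r x => r 1 = F x (r 0))).
    + exact (def1_ren _ (fun i => match i with 0 => 2 | 1 => 0 | _ => 1 end) H).
    + exact (fun1_ren f (fun i => S (S i)) Hf).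
  - exact (fun1_ren g S Hg).
Qed.

Lemma fun1_var i : Fun1 (fun r => r i).
Proof. apply fun1_poly, poly_var. Qed.

Lemma fun1_const n : Fun1 (fun _ => n).
Proof. apply fun1_poly, poly_const. Qed.

Lemma fun1_succ f : Fun1 f -> Fun1 (fun r => S (f r)).
Proof. apply fun1_comp1, fun1_poly, poly_succ, poly_var. Qed.

Lemma fun1_plus f g : Fun1 f -> Fun1 g -> Fun1 (fun r => f r + g r).
Proof. apply (fun1_comp2 Nat.add), fun1_poly, poly_plus; apply poly_var. Qed.

Lemma fun1_pair f g : Fun1 f -> Fun1 g -> Fun1 (fun r => to_nat (f r, g r)).
Proof.
  apply (fun1_comp2 (fun x y => to_nat (x, y))).
  apply def1_D0. unfold tail.
  apply (def0_ext (fun r => r 0 + r 0 = r 2 + r 2 + (r 2 + r 1) * S (r 2 + r 1))).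
  - apply def0_eq; repeat first [apply poly_var | apply poly_plus | apply poly_mult
                              | apply poly_succ].
  - intros r. pose proof (to_nat_spec (r 1) (r 2)). lia.
Qed.

Lemma def1_eq f g : Fun1 f -> Fun1 g -> Def1 (fun r => f r = g r).
Proof. apply (def1_rel2 Logic.eq), def1_D0, def0_eq; apply poly_var. Qed.

Lemma def1_ne f g : Fun1 f -> Fun1 g -> Def1 (fun r => f r <> g r).
Proof.
  apply (def1_rel2 (fun x y => x <> y)), def1_D0, def0_not, def0_eq; apply poly_var.
Qed.

Lemma def1_le f g : Fun1 f -> Fun1 g -> Def1 (fun r => f r <= g r).
Proof. apply (def1_rel2 le), def1_D0, def0_le; apply poly_var. Qed.

Lemma def1_lt f g : Fun1 f -> Fun1 g -> Def1 (fun r => f r < g r).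
Proof. intros Hf. apply def1_le. now apply fun1_succ. Qed.

(** * Inductive definitions *)

(** Goedel's coding of finite sets: [z] belongs to the set coded by [a] and [b] if
    the modulus 1 + (z + 1) b divides [a]. *)
Definition elem (a b z : nat) : Prop := exists q, q <= a /\ q * S (S z * b) = a.

(** A common divisor of the moduli of [z] and [y] divides (y - z) M!, while it is
    coprime to M!; as y - z divides M!, it is 1. *)
Lemma moduli_coprime M z y :
  z < y -> y <= M ->
  Nat.gcd (S (S z * fact M)) (S (S y * fact M)) = 1.
Proof.
  intros Hzy Hy. set (b := fact M).
  set (d := Nat.gcd (S (S z * b)) (S (S y * b))).
  assert (Hz : Nat.divide d (S (S z * b))) by apply Nat.gcd_divide_l.
  assert (Hy' : Nat.divide d (S (S y * b))) by apply Nat.gcd_divide_r.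
  assert (Hdb : Nat.gcd d b = 1).
  { apply Nat.divide_1_r.
    apply (Nat.divide_add_cancel_r _ (S z * b)).
    - apply Nat.divide_mul_r, Nat.gcd_divide_r.
    - rewrite Nat.add_1_r.
      eapply Nat.divide_trans; [apply Nat.gcd_divide_l|exact Hz]. }
  assert (Hd : Nat.divide d (b * (y - z))).
  { apply (Nat.divide_add_cancel_r _ (S (S z * b)) _ Hz).
    replace (S (S z * b) + b * (y - z)) with (S (S y * b)); [exact Hy'|]. nia. }
  apply Nat.gauss in Hd; [|exact Hdb].
  assert (Hyb : forall n k, 0 < k <= n -> Nat.divide k (fact n)).
  { clear. induction n as [|n IH]; intros k Hk; [lia|].
    change (fact (S n)) with (S n * fact n).
    destruct (Nat.eq_dec k (S n)) as [->|Hn].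
    - apply Nat.divide_factor_l.
    - apply Nat.divide_mul_r, IH. lia. }
  assert (Hdb' : Nat.divide d b).
  { eapply Nat.divide_trans; [exact Hd|]. apply Hyb. lia. }
  apply Nat.divide_1_r. rewrite <- Hdb.
  apply Nat.gcd_greatest; [apply Nat.divide_refl|exact Hdb'].
Qed.

(** Take for [a] the product of the moduli of the elements: by coprimality the
    modulus of any other [z] up to [M] cannot divide it. *)
Lemma finite_set_code M L :
  (forall z, In z L -> z <= M) ->
  exists a b, forall z, z <= M -> (elem a b z <-> In z L).
Proof.
  intros HL. set (b := fact M).
  set (prod := fold_right (fun z a => S (S z * b) * a) 1).
  exists (prod L), b. intros z Hz. split.
  - intros (q & _ & Hq).
    assert (Hd : Nat.divide (S (S z * b)) (prod L)) by (exists q; lia).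
    clear q Hq. induction L as [|y L IH].
    + apply Nat.divide_1_r in Hd. pose proof (lt_O_fact M). fold b in H. nia.
    + destruct (Nat.eq_dec y z) as [->|Hn]; [now left|]. right.
      apply IH; [intros u Hu; apply HL; now right|].
      apply (Nat.gauss _ (S (S y * b))); [exact Hd|].
      destruct (Nat.lt_ge_cases z y).
      * apply moduli_coprime; [lia|]. apply HL. now left.
      * rewrite Nat.gcd_comm. apply moduli_coprime; [lia|exact Hz].
  - intros Hin.
    assert (Hd : exists q, q * S (S z * b) = prod L).
    { clear HL Hz. induction L as [|y L IH]; [destruct Hin|].
      change (prod (y :: L)) with (S (S y * b) * prod L).
      destruct Hin as [->|Hin]; [exists (prod L); lia|].
      destruct (IH Hin) as [q Hq]. exists (S (S y * b) * q). nia. }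
    destruct Hd as [q Hq]. exists q. split; [nia|exact Hq].
Qed.

Lemma def0_elem : Def0 (fun r => elem (r 0) (r 1) (r 2)).
Proof.
  apply (def0_bex (fun r => r 0) (fun r q => q * S (S (r 2) * r 1) = r 0));
    [apply poly_var|].
  unfold tail.
  apply def0_eq; repeat first [apply poly_var | apply poly_mult | apply poly_succ].
Qed.

Lemma def1_elem f g h : Fun1 f -> Fun1 g -> Fun1 h -> Def1 (fun r => elem (f r) (g r) (h r)).
Proof. apply (def1_rel3 elem), def1_D0, def0_elem. Qed.

Lemma def1_not_elem f g h :
  Fun1 f -> Fun1 g -> Fun1 h -> Def1 (fun r => ~ elem (f r) (g r) (h r)).
Proof. apply (def1_rel3 (fun a b z => ~ elem a b z)), def1_D0, def0_not, def0_elem. Qed.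

Ltac def1_step :=
  lazymatch goal with
  | |- Fun1 (fun r => r _) => apply fun1_var
  | |- Fun1 (fun _ => ?c) => apply (fun1_const c)
  | |- Fun1 (fun r => S (@?f r)) => apply (fun1_succ f)
  | |- Fun1 (fun r => @?f r + @?g r) => apply (fun1_plus f g)
  | |- Fun1 (fun r => to_nat (@?f r, @?g r)) => apply (fun1_pair f g)
  | |- Def1 (fun r => @?f r = @?g r) => apply (def1_eq f g)
  | |- Def1 (fun r => @?f r <> @?g r) => apply (def1_ne f g)
  | |- Def1 (fun r => @?f r <= @?g r) => apply (def1_le f g)
  | |- Def1 (fun r => @?f r < @?g r) => apply (def1_lt f g)
  | |- Def1 (fun r => elem (@?f r) (@?g r) (@?h r)) => apply (def1_elem f g h)
  | |- Def1 (fun r => ~ elem (@?f r) (@?g r) (@?h r)) => apply (def1_not_elem f g h)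
  | |- Def1 (fun r => @?P r /\ @?Q r) => apply (def1_and P Q)
  | |- Def1 (fun r => @?P r \/ @?Q r) => apply (def1_or P Q)
  | |- Def1 (fun r => exists x, @?Q r x) => apply (def1_ex Q); unfold tail
  end; cbv beta.
Ltac def1 := unfold tail; repeat def1_step.

(** Two premises suffice for all the syntactic relations below; a rule with one
    premise uses it twice. *)
Inductive closure (Ax : nat -> Prop) (Rule : nat -> nat -> nat -> Prop) : nat -> Prop :=
| closure_ax x : Ax x -> closure Ax Rule x
| closure_rule x y z :
    closure Ax Rule y -> closure Ax Rule z -> Rule x y z -> closure Ax Rule x.

Lemma closure_tree Ax Rule x :
  closure Ax Rule x ->
  exists (L : list (nat * nat)) (n : nat), In (n, x) L /\
    forall i y, In (i, y) L -> Ax y \/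
      exists j k u v, j < i /\ k < i /\ In (j, u) L /\ In (k, v) L /\ Rule y u v.
Proof.
  induction 1 as [x Hx|x y z _ (L1 & n1 & I1 & H1) _ (L2 & n2 & I2 & H2) HR].
  - exists [(0, x)], 0. split; [now left|].
    intros i y [E|[]]. injection E as <- <-. now left.
  - exists ((S (n1 + n2), x) :: L1 ++ L2), (S (n1 + n2)). split; [now left|].
    intros i u [E|Hu].
    + injection E as <- <-. right. exists n1, n2, y, z.
      repeat split; try lia; try exact HR; right; apply in_or_app; auto.
    + apply in_app_or in Hu. destruct Hu as [Hu|Hu].
      * destruct (H1 _ _ Hu) as [|(j & k & v & w & ? & ? & ? & ? & ?)]; [now left|].
        right. exists j, k, v, w.
        repeat split; auto; right; apply in_or_app; auto.
      * destruct (H2 _ _ Hu) as [|(j & k & v & w & ? & ? & ? & ? & ?)]; [now left|].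
        right. exists j, k, v, w.
        repeat split; auto; right; apply in_or_app; auto.
Qed.

Lemma pair_bound x y m : x <= m -> y <= m -> to_nat (x, y) <= to_nat (m, m).
Proof.
  intros Hx Hy. pose proof (to_nat_spec x y). pose proof (to_nat_spec m m).
  assert ((y + x) * S (y + x) <= (m + m) * S (m + m)) by (apply Nat.mul_le_mono; lia).
  lia.
Qed.

(** Membership in an inductively defined set is witnessed by a coded finite set
    of pairs (rank, element) in which each element is justified by elements of
    smaller rank. *)
Lemma closure_code Ax Rule x :
  closure Ax Rule x <->
  exists m a b n, n <= m /\ x <= m /\ elem a b (to_nat (n, x)) /\
    forall i, i <= m -> forall y, y <= m ->
      ~ elem a b (to_nat (i, y)) \/ Ax y \/
      exists j k u v, j < i /\ k < i /\ u <= m /\ v <= m /\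
        elem a b (to_nat (j, u)) /\ elem a b (to_nat (k, v)) /\ Rule y u v.
Proof.
  split.
  - intros H. destruct (closure_tree _ _ _ H) as (L & n & Hn & HL). clear H.
    assert (HB : exists m, forall i y, In (i, y) L -> i <= m /\ y <= m).
    { clear. induction L as [|[i y] L [m IH]]; [exists 0; intros ? ? []|].
      exists (i + y + m). intros j z [E|H]; [injection E; lia|].
      specialize (IH _ _ H). lia. }
    destruct HB as [m HB].
    destruct (finite_set_code (to_nat (m, m)) (map to_nat L)) as (a & b & Hab).
    { intros z Hz. apply in_map_iff in Hz. destruct Hz as ([i y] & <- & Hz).
      apply HB in Hz. now apply pair_bound. }
    assert (E : forall i y, i <= m -> y <= m ->
                  (elem a b (to_nat (i, y)) <-> In (i, y) L)).
    { intros i y Hi Hy. rewrite Hab by now apply pair_bound. split.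
      - intros K. apply in_map_iff in K. destruct K as (p & Hp & K).
        apply (f_equal of_nat) in Hp. rewrite !cancel_of_to in Hp. now subst p.
      - apply in_map. }
    destruct (HB _ _ Hn) as [Hnm Hxm].
    exists m, a, b, n. repeat split; auto; [now apply E|].
    intros i Hi y Hy. destruct (classic (elem a b (to_nat (i, y)))) as [K|K]; [|auto].
    right. apply E in K; auto.
    destruct (HL _ _ K) as [|(j & k & u & v & Hj & Hk & Hu & Hv & HR)]; [auto|].
    right. exists j, k, u, v. destruct (HB _ _ Hu), (HB _ _ Hv).
    repeat split; auto; now apply E.
  - intros (m & a & b & n & Hn & Hx & E & H). revert x Hx E.
    induction n as [n IH] using lt_wf_ind. intros x Hx E.
    destruct (H n Hn x Hx) as [K|[K|(j & k & u & v & Hj & Hk & Hu & Hv & Eu & Ev & HR)]].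
    + contradiction.
    + now constructor.
    + apply (closure_rule _ _ x u v); [| |exact HR].
      * apply (IH j); auto; lia.
      * apply (IH k); auto; lia.
Qed.

(** The workhorse: an inductively defined set with definable axioms and rules is
    definable, by [closure_code]. *)
Lemma def1_closure (Ax : (nat -> nat) -> nat -> Prop)
    (Rule : (nat -> nat) -> nat -> nat -> nat -> Prop) f :
  Def1 (fun r => Ax (tail r) (r 0)) ->
  Def1 (fun r => Rule (tail (tail (tail r))) (r 0) (r 1) (r 2)) ->
  Fun1 f -> Def1 (fun r => closure (Ax r) (Rule r) (f r)).
Proof.
  intros HA HR. apply (def1_let (fun r x => closure (Ax r) (Rule r) x)).
  eapply def1_ext; [|intros r; symmetry; apply closure_code].
  apply def1_ex, def1_ex, def1_ex, def1_ex. unfold tail.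
  repeat (apply def1_and; [def1|]).
  apply (def1_ball 3). unfold tail. apply (def1_ball 4). unfold tail.
  apply def1_or; [def1|]. apply def1_or.
  - exact (def1_ren _ (fun i => match i with 0 => 0 | S i => 7 + i end) HA).
  - apply def1_ex, def1_ex, def1_ex, def1_ex. unfold tail.
    repeat (apply def1_and; [def1|]).
    exact (def1_ren _ (fun i => match i with
                              | 0 => 4 | 1 => 1 | 2 => 0 | S (S (S i)) => 11 + i end) HR).
Qed.

(** * Definable predicates are recursively enumerable *)

(** An equivalence, so that no separate proof that [eval] is deterministic is
    called for. *)
Definition computes (f : rec) (F : list nat -> nat) : Prop :=
  forall xs y, eval f xs y <-> y = F xs.

Lemma computes_proj i : computes (RProj i) (fun xs => nth i xs 0).
Proof.
  intros xs y. split; [intros H; now inversion H|intros ->; constructor].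
Qed.

Lemma computes_zero : computes RZero (fun _ => 0).
Proof.
  intros xs y. split; [intros H; now inversion H|intros ->; constructor].
Qed.

Lemma eval_succ_iff xs y : eval RSucc xs y <-> y = S (nth 0 xs 0).
Proof. split; [intros H; now inversion H|intros ->; constructor]. Qed.

Lemma eval_comp1 f g G xs z :
  computes g G -> (eval (RComp f [g]) xs z <-> eval f [G xs] z).
Proof.
  intros Hg. split.
  - intros H. inversion H as [| | |f' gs' xs' ys z' HF Hf| | |]; subst.
    inversion HF as [|? a ? ys' Ha HF']; subst. inversion HF'; subst.
    apply Hg in Ha. now subst a.
  - intros H. apply (eval_comp _ _ _ [G xs]); [|exact H].
    repeat constructor. now apply Hg.
Qed.

Lemma eval_comp2 f g h G H xs z :
  computes g G -> computes h H ->
  (eval (RComp f [g; h]) xs z <-> eval f [G xs; H xs] z).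
Proof.
  intros Hg Hh. split.
  - intros E. inversion E as [| | |f' gs' xs' ys z' HF Hf| | |]; subst.
    inversion HF as [|? a ? ys' Ha HF']; subst.
    inversion HF' as [|? b ? ys'' Hb HF'']; subst. inversion HF''; subst.
    apply Hg in Ha. apply Hh in Hb. now subst a b.
  - intros E. apply (eval_comp _ _ _ [G xs; H xs]); [|exact E].
    repeat constructor; [now apply Hg|now apply Hh].
Qed.

Lemma eval_rec f g F G n xs y :
  computes f F -> computes g G ->
  (eval (RRec f g) (n :: xs) y <->
   y = nat_rec _ (F xs) (fun n r => G (n :: r :: xs)) n).
Proof.
  intros Hf Hg. revert y. induction n as [|n IH]; intros y; split.
  - intros E. inversion E; subst. now apply Hf.
  - intros ->. constructor. now apply Hf.
  - intros E. inversion E as [| | | | |f' g' n' xs' r y' Hr Hy|]; subst.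
    apply IH in Hr. subst r. now apply Hg.
  - intros ->. apply (eval_recS _ _ _ _ _ _ (proj2 (IH _) eq_refl)). now apply Hg.
Qed.

Lemma computes_succ g G :
  computes g G -> computes (RComp RSucc [g]) (fun xs => S (G xs)).
Proof. intros Hg xs y. rewrite (eval_comp1 _ _ G) by exact Hg. apply eval_succ_iff. Qed.

Definition rec_add : rec := RRec (RProj 0) (RComp RSucc [RProj 1]).


Lemma eval_add a b y : eval rec_add [a; b] y <-> y = a + b.
Proof.
  unfold rec_add.
  rewrite eval_rec by (apply computes_proj || apply computes_succ, computes_proj).
  enough (E : forall c, nat_rec _ c (fun _ r => S r) a = a + c) by (now rewrite <- E).
  intros c. induction a; simpl in *; congruence.
Qed.

Lemma computes_add f g F G :
  computes f F -> computes g G ->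
  computes (RComp rec_add [f; g]) (fun xs => F xs + G xs).
Proof.
  intros Hf Hg xs y. rewrite (eval_comp2 _ _ _ F G) by assumption. apply eval_add.
Qed.

Definition rec_mul : rec := RRec RZero (RComp rec_add [RProj 2; RProj 1]).

Lemma eval_mul a b y : eval rec_mul [a; b] y <-> y = a * b.
Proof.
  unfold rec_mul.
  rewrite eval_rec by (apply computes_zero || apply computes_add; apply computes_proj).
  enough (E : nat_rec _ 0 (fun _ r => b + r) a = a * b) by (now rewrite <- E).
  induction a; simpl in *; congruence.
Qed.

Lemma computes_mul f g F G :
  computes f F -> computes g G ->
  computes (RComp rec_mul [f; g]) (fun xs => F xs * G xs).
Proof.
  intros Hf Hg xs y. rewrite (eval_comp2 _ _ _ F G) by assumption. apply eval_mul.
Qed.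

Definition rec_pred : rec := RRec RZero (RProj 0).

Lemma eval_pred a xs y : eval rec_pred (a :: xs) y <-> y = pred a.
Proof.
  unfold rec_pred. rewrite eval_rec by (apply computes_zero || apply computes_proj).
  now destruct a.
Qed.

Lemma computes_pred f F :
  computes f F -> computes (RComp rec_pred [f]) (fun xs => pred (F xs)).
Proof. intros Hf xs y. rewrite (eval_comp1 _ _ F) by exact Hf. apply eval_pred. Qed.

(** The first argument is the one subtracted. *)
Definition rec_sub : rec := RRec (RProj 0) (RComp rec_pred [RProj 1]).

Lemma eval_sub a b y : eval rec_sub [a; b] y <-> y = b - a.
Proof.
  unfold rec_sub.
  rewrite eval_rec by (apply computes_proj || apply computes_pred, computes_proj).
  enough (E : nat_rec _ b (fun _ r => pred r) a = b - a) by (now rewrite <- E).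
  induction a as [|a IH]; simpl in *; lia.
Qed.

Lemma computes_sub f g F G :
  computes f F -> computes g G ->
  computes (RComp rec_sub [g; f]) (fun xs => F xs - G xs).
Proof.
  intros Hf Hg xs y. rewrite (eval_comp2 _ _ _ G F) by assumption. apply eval_sub.
Qed.

Definition env (xs : list nat) (i : nat) : nat := nth i xs 0.

Lemma scons_env x xs : scons x (env xs) = env (x :: xs).
Proof. extensionality i. now destruct i. Qed.

Lemma term_computable t : exists f, computes f (fun xs => ev (env xs) t).
Proof.
  induction t as [x| |t [f Hf]|s [f Hf] t [g Hg]|s [f Hf] t [g Hg]]; simpl.
  - eexists. apply computes_proj.
  - eexists. apply computes_zero.
  - eexists. apply computes_succ, Hf.
  - eexists. apply computes_add; eassumption.
  - eexists. apply computes_mul; eassumption.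
Qed.

Fixpoint least_zero (h : nat -> nat) (n : nat) : nat :=
  match n with
  | 0 => 0
  | S n => if h 0 =? 0 then 0 else S (least_zero (fun x => h (S x)) n)
  end.

Lemma least_zero_spec n : forall h, h n = 0 ->
  h (least_zero h n) = 0 /\ forall z, z < least_zero h n -> h z <> 0.
Proof.
  induction n as [|n IH]; intros h Hn; simpl.
  - split; [exact Hn|lia].
  - destruct (Nat.eqb_spec (h 0) 0) as [E|E]; [split; [exact E|lia]|].
    destruct (IH (fun x => h (S x)) Hn) as [H1 H2]. split; [exact H1|].
    intros [|z] Hz; [exact E|]. apply H2. lia.
Qed.

Lemma computes_mu f F B :
  computes f F -> (forall xs, F (B xs :: xs) = 0) ->
  computes (RMu f) (fun xs => least_zero (fun x => F (x :: xs)) (B xs)).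
Proof.
  intros Hf HB xs y.
  destruct (least_zero_spec _ (fun x => F (x :: xs)) (HB xs)) as [H1 H2].
  set (m := least_zero _ _) in *. split.
  - intros E. inversion E as [| | | | | |f' xs' y' E1 E2]; subst.
    apply Hf in E1. destruct (Nat.lt_trichotomy y m) as [L|[L|L]]; [|exact L|].
    + destruct (H2 _ L). now symmetry.
    + destruct (E2 _ L) as [v Hv]. apply Hf in Hv. congruence.
  - intros ->. constructor; [apply Hf; congruence|].
    intros z Hz. exists (pred (F (z :: xs))). apply Hf.
    specialize (H2 z Hz). lia.
Qed.

(** Truth is represented by the value 0. A bounded quantifier is a search for
    the least counterexample or witness that stops when it passes the bound. *)
Lemma Delta0_computable A :
  Delta0 A -> exists f F, computes f F /\ forall xs, F xs = 0 <-> sat (env xs) A.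
Proof.
  induction 1 as [s t| |A B _ (f & F & Hf & HF) _ (g & G & Hg & HG)
                 |t A _ (f & F & Hf & HF)|t A _ (f & F & Hf & HF)].
  - destruct (term_computable s) as [f Hf], (term_computable t) as [g Hg].
    do 2 eexists. split.
    + exact (computes_add _ _ _ _ (computes_sub _ _ _ _ Hf Hg)
                                  (computes_sub _ _ _ _ Hg Hf)).
    + intros xs. simpl. lia.
  - do 2 eexists. split; [apply computes_succ, computes_zero|].
    intros xs. simpl. lia.
  - do 2 eexists. split.
    + exact (computes_mul _ _ _ _
        (computes_sub _ _ _ _ (computes_succ _ _ computes_zero) Hf) Hg).
    + intros xs. simpl. specialize (HF xs). specialize (HG xs).
      rewrite <- HF, <- HG. destruct (F xs); simpl; lia.
  - destruct (term_computable t) as [g Hg].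
    destruct (term_computable (tshift t)) as [g' Hg'].
    set (N := fun xs => ev (env xs) t).
    pose (H := fun xs => (S (ev (env xs) (tshift t)) - nth 0 xs 0) * (1 - F xs)).
    assert (HH : forall x xs, H (x :: xs) = (S (N xs) - x) * (1 - F (x :: xs))).
    { intros x xs. unfold H. now rewrite <- scons_env, ev_tshift. }
    eexists. exists (fun xs => S (N xs) - least_zero (fun x => H (x :: xs)) (S (N xs))).
    split.
    + apply computes_sub; [apply computes_succ, Hg|].
      eapply (computes_mu _ H (fun xs => S (N xs))).
      * apply computes_mul; apply computes_sub; try apply computes_succ; try eassumption;
          first [apply computes_proj|apply computes_zero].
      * intros xs. rewrite HH. lia.
    + intros xs. rewrite sat_ball. fold (N xs).
      destruct (least_zero_spec (S (N xs)) (fun x => H (x :: xs))) as [H1 H2];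
        [rewrite HH; lia|].
      set (m := least_zero _ _) in *. split.
      * intros Hm x Hx. rewrite scons_env, <- HF.
        specialize (H2 x ltac:(lia)). rewrite HH in H2. nia.
      * intros K. destruct (Nat.le_gt_cases (S (N xs)) m) as [|Hm]; [lia|].
        rewrite HH in H1. specialize (K m ltac:(lia)).
        rewrite scons_env, <- HF in K. rewrite K in H1. lia.
  - destruct (term_computable t) as [g Hg].
    destruct (term_computable (tshift t)) as [g' Hg'].
    set (N := fun xs => ev (env xs) t).
    pose (H := fun xs => (S (ev (env xs) (tshift t)) - nth 0 xs 0) * F xs).
    assert (HH : forall x xs, H (x :: xs) = (S (N xs) - x) * F (x :: xs)).
    { intros x xs. unfold H. now rewrite <- scons_env, ev_tshift. }
    eexists. exists (fun xs => least_zero (fun x => H (x :: xs)) (S (N xs)) - N xs).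
    split.
    + apply computes_sub; [|exact Hg].
      eapply (computes_mu _ H (fun xs => S (N xs))).
      * apply computes_mul; [|exact Hf].
        apply computes_sub; [apply computes_succ, Hg'|apply computes_proj].
      * intros xs. rewrite HH. lia.
    + intros xs. rewrite sat_bex. fold (N xs).
      destruct (least_zero_spec (S (N xs)) (fun x => H (x :: xs))) as [H1 H2];
        [rewrite HH; lia|].
      set (m := least_zero _ _) in *. split.
      * intros Hm. exists m. split; [lia|]. rewrite scons_env, <- HF.
        rewrite HH in H1. nia.
      * intros (x & Hx & K). rewrite scons_env, <- HF in K.
        destruct (Nat.le_gt_cases m x) as [|Hm]; [lia|].
        specialize (H2 x Hm). rewrite HH, K in H2. lia.
Qed.

Lemma def1_semidecidable P :
  Def1 P -> exists f, forall xs, P (env xs) <-> exists y, eval f xs y.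
Proof.
  intros (R & (A & HA & H) & HR).
  destruct (Delta0_computable A HA) as (f & F & Hf & HF).
  exists (RMu f). intros xs. rewrite HR.
  assert (E : forall w, R (scons w (env xs)) <-> F (w :: xs) = 0).
  { intros w. rewrite <- H, HF. now rewrite scons_env. }
  split.
  - intros [w Hw]. apply E in Hw.
    destruct (least_zero_spec w (fun x => F (x :: xs)) Hw) as [H1 H2].
    eexists. constructor; [apply Hf; symmetry; exact H1|].
    intros z Hz. exists (pred (F (z :: xs))). apply Hf.
    specialize (H2 z Hz). lia.
  - intros [w Hw]. exists w. apply E. inversion Hw as [| | | | | |f' xs' y' E1 E2]; subst.
    apply Hf in E1. now symmetry.
Qed.

Lemma def1_re_set (P : nat -> Prop) : Def1 (fun r => P (r 0)) -> re_set P.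
Proof.
  intros H. apply def1_semidecidable in H. destruct H as [f Hf].
  exists f. intros x. exact (Hf [x]).
Qed.

Lemma def1_uniformly_re (P : nat -> nat -> Prop) :
  Def1 (fun r => P (r 0) (r 1)) -> uniformly_re P.
Proof.
  intros H. apply def1_semidecidable in H. destruct H as [f Hf].
  exists f. intros i x. exact (Hf [i; x]).
Qed.

(** * Arithmetization of syntax *)

(* Keeps reduction from computing pairs with a concrete tag. *)
Opaque to_nat.

Notation cvar x := (to_nat (0, x)).
Notation czero := (to_nat (1, 0)).
Notation csucc a := (to_nat (2, a)).
Notation cplus a b := (to_nat (3, to_nat (a, b))).
Notation cmult a b := (to_nat (4, to_nat (a, b))).
Notation ceq a b := (to_nat (0, to_nat (a, b))).
Notation cbot := (to_nat (1, 0)).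
Notation cimp a b := (to_nat (2, to_nat (a, b))).
Notation call a := (to_nat (3, a)).
Notation cneg a := (cimp a cbot).
Notation quintuple d u c a b := (to_nat (d, to_nat (u, to_nat (c, to_nat (a, b))))).

Lemma to_nat_inj a b c d : to_nat (a, b) = to_nat (c, d) -> a = c /\ b = d.
Proof.
  intros H. apply (f_equal of_nat) in H. rewrite !cancel_of_to in H.
  now injection H.
Qed.

Ltac inj :=
  repeat match goal with
  | H : to_nat (_, _) = to_nat (_, _) |- _ => apply to_nat_inj in H; destruct H
  end; try discriminate.

Lemma tcode_inj s : forall t, tcode s = tcode t -> s = t.
Proof.
  induction s; intros []; cbn [tcode]; intros H; inj; subst; f_equal; auto.
Qed.

Lemma code_inj A : forall B, code A = code B -> A = B.
Proof.
  induction A; intros []; cbn [code]; intros H; inj; subst; f_equal;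
    auto using tcode_inj.
Qed.

Lemma code_imp_inv C a b :
  code C = cimp a b -> exists A B, C = Imp A B /\ code A = a /\ code B = b.
Proof. destruct C; cbn [code]; intros H; inj. eauto. Qed.

Ltac codes_inj :=
  inj; subst;
  repeat match goal with
  | H : tcode _ = tcode _ |- _ => apply tcode_inj in H
  | H : code _ = code _ |- _ => apply code_inj in H
  end; subst.

(** ** Boundedness *)

Definition TBounded (k a : nat) : Prop := exists t, tbounded k t /\ a = tcode t.

(** The pairs (k, code of a term bounded by k) are generated from variables and
    zero; the other relations below are generated in the same way, with their
    arguments packed into one number. *)
Definition tb_ax (x : nat) : Prop :=
  exists k, x = to_nat (k, czero) \/ exists v, v < k /\ x = to_nat (k, cvar v).
Definition tb_rule (x y z : nat) : Prop :=
  exists k a b, y = to_nat (k, a) /\ z = to_nat (k, b) /\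
    (x = to_nat (k, csucc a) \/ x = to_nat (k, cplus a b) \/
     x = to_nat (k, cmult a b)).

Lemma TBounded_closure k a :
  TBounded k a <-> closure tb_ax tb_rule (to_nat (k, a)).
Proof.
  split.
  - intros (t & Ht & ->). revert Ht.
    induction t as [x| |t IH|s IHs t IHt|s IHs t IHt]; cbn [tcode tbounded]; intros Ht.
    + apply closure_ax. exists k. eauto.
    + apply closure_ax. exists k. auto.
    + apply (closure_rule _ _ _ _ _ (IH Ht) (IH Ht)).
      exists k, (tcode t), (tcode t). auto.
    + destruct Ht as [Hs Ht]. apply (closure_rule _ _ _ _ _ (IHs Hs) (IHt Ht)).
      exists k, (tcode s), (tcode t). auto.
    + destruct Ht as [Hs Ht]. apply (closure_rule _ _ _ _ _ (IHs Hs) (IHt Ht)).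
      exists k, (tcode s), (tcode t). auto.
  - intros H.
    enough (K : forall x, closure tb_ax tb_rule x ->
              exists k t, tbounded k t /\ x = to_nat (k, tcode t)).
    { destruct (K _ H) as (k' & t & Ht & E). inj. subst. now exists t. }
    clear. induction 1 as [x (k & [->|(v & Hv & ->)])
                          |x y z _ (k & s & Hs & ->) _ (k' & t & Ht & ->)
                           (k'' & a & b & E & E' & [->|[->| ->]])].
    + now exists k, Zero.
    + now exists k, (Var v).
    + codes_inj. now exists k'', (Succ s).
    + codes_inj. now exists k'', (Plus s t).
    + codes_inj. now exists k'', (Mult s t).
Qed.

Lemma def1_TBounded f g : Fun1 f -> Fun1 g -> Def1 (fun r => TBounded (f r) (g r)).
Proof.
  intros Hf Hg. eapply def1_ext; [|intros r; symmetry; apply TBounded_closure].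
  apply (def1_closure (fun _ => tb_ax) (fun _ => tb_rule)).
  - unfold tb_ax. def1.
  - unfold tb_rule. def1.
  - now apply fun1_pair.
Qed.

Definition is_term (a : nat) : Prop := exists k, TBounded k a.

Lemma tbounded_mono t k k' : k <= k' -> tbounded k t -> tbounded k' t.
Proof. intros Hk. induction t; simpl; firstorder lia. Qed.

Lemma is_term_spec a : is_term a <-> exists t, a = tcode t.
Proof.
  split; [intros (k & t & _ & E); eauto|].
  intros [t ->]. enough (exists k, tbounded k t) as [k Hk] by (exists k, t; auto).
  induction t as [x| |t [k IH]|s [k IHs] t [l IHt]|s [k IHs] t [l IHt]]; simpl.
  - exists (S x). lia.
  - now exists 0.
  - now exists k.
  - exists (k + l). split; eapply tbounded_mono; try eassumption; lia.
  - exists (k + l). split; eapply tbounded_mono; try eassumption; lia.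
Qed.

Definition Bounded (k a : nat) : Prop := exists A, bounded k A /\ a = code A.

Definition b_ax (x : nat) : Prop :=
  exists k, x = to_nat (k, cbot) \/
    exists a b, TBounded k a /\ TBounded k b /\ x = to_nat (k, ceq a b).
Definition b_rule (x y z : nat) : Prop :=
  exists k a b,
    (y = to_nat (k, a) /\ z = to_nat (k, b) /\ x = to_nat (k, cimp a b)) \/
    (y = to_nat (S k, a) /\ x = to_nat (k, call a)).

Lemma Bounded_closure k a :
  Bounded k a <-> closure b_ax b_rule (to_nat (k, a)).
Proof.
  split.
  - intros (A & HA & ->). revert k HA.
    induction A as [s t| |A IHA B IHB|A IH]; cbn [code bounded]; intros k HA.
    + destruct HA as [Hs Ht]. apply closure_ax. exists k. right.
      exists (tcode s), (tcode t). repeat split; [now exists s|now exists t].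
    + apply closure_ax. exists k. auto.
    + destruct HA as [HA HB]. apply (closure_rule _ _ _ _ _ (IHA _ HA) (IHB _ HB)).
      exists k, (code A), (code B). auto.
    + apply (closure_rule _ _ _ _ _ (IH _ HA) (IH _ HA)).
      exists k, (code A), 0. auto.
  - intros H.
    enough (K : forall x, closure b_ax b_rule x ->
              exists k A, bounded k A /\ x = to_nat (k, code A)).
    { destruct (K _ H) as (k' & A & HA & E). inj. subst. now exists A. }
    clear. induction 1 as [x (k & [->|(a & b & (s & Hs & ->) & (t & Ht & ->) & ->)])
                          |x y z _ (k & A & HA & ->) _ (k' & B & HB & ->)
                           (k'' & a & b & [(E & E' & ->)|(E & ->)])].
    + now exists k, Bot.
    + now exists k, (Eq s t).
    + codes_inj. now exists k'', (Imp A B).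
    + codes_inj. now exists k'', (All A).
Qed.

Lemma def1_Bounded f g : Fun1 f -> Fun1 g -> Def1 (fun r => Bounded (f r) (g r)).
Proof.
  intros Hf Hg. eapply def1_ext; [|intros r; symmetry; apply Bounded_closure].
  apply (def1_closure (fun _ => b_ax) (fun _ => b_rule)).
  - unfold b_ax. def1; apply def1_TBounded; def1.
  - unfold b_rule. def1.
  - now apply fun1_pair.
Qed.

(** Not every number is a code: axiom schemes must be restricted to numbers that
    are, or a coded derivation could not be read back. *)
Definition is_form (a : nat) : Prop := exists k, Bounded k a.

Lemma bounded_mono A : forall k k', k <= k' -> bounded k A -> bounded k' A.
Proof.
  induction A as [s t| |A IHA B IHB|A IH]; simpl; intros k k' Hk H.
  - destruct H. split; eapply tbounded_mono; eassumption.
  - exact H.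
  - destruct H. split; eauto.
  - apply (IH (S k)); [lia|exact H].
Qed.

Lemma is_form_spec a : is_form a <-> exists A, a = code A.
Proof.
  split; [intros (k & A & _ & E); eauto|].
  intros [A ->]. enough (exists k, bounded k A) as [k Hk] by (exists k, A; auto).
  induction A as [s t| |A [k IHA] B [l IHB]|A [k IH]]; simpl.
  - destruct (proj2 (is_term_spec _) (ex_intro _ s eq_refl)) as (k & s' & Hs & E).
    destruct (proj2 (is_term_spec _) (ex_intro _ t eq_refl)) as (l & t' & Ht & E').
    codes_inj. exists (k + l). split; eapply tbounded_mono; try eassumption; lia.
  - now exists 0.
  - exists (k + l). split; eapply bounded_mono; try eassumption; lia.
  - exists k. eapply bounded_mono; [|exact IH]. lia.
Qed.

Ltac def1_syntax :=
  repeat (unfold is_form, is_term;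
    lazymatch goal with
    | |- Def1 (fun r => TBounded (@?f r) (@?g r)) => apply (def1_TBounded f g)
    | |- Def1 (fun r => Bounded (@?f r) (@?g r)) => apply (def1_Bounded f g)
    | _ => def1_step
    end).

(** ** Substitution *)

(** This family of substitutions contains instantiation, shifting and the
    substitution of the induction scheme, and it is closed under [up]. *)
Definition sub (d : nat) (u : term) (c x : nat) : term :=
  if x <? d then Var x else if x =? d then u else Var (x - 1 + c).

Lemma up_sub d u c : up (sub d u c) = sub (S d) (tshift u) c.
Proof.
  extensionality x. destruct x as [|x]; [reflexivity|].
  unfold up, sub. change (S x <? S d) with (x <? d). change (S x =? S d) with (x =? d).
  destruct (Nat.ltb_spec x d); [reflexivity|].
  destruct (Nat.eqb_spec x d); [reflexivity|]. cbn. f_equal. lia.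
Qed.

Lemma tshift_sub t : tshift t = tsubst (sub 0 (Var 1) 2) t.
Proof.
  unfold tshift. f_equal. extensionality x.
  destruct x; [reflexivity|]. cbn. f_equal. lia.
Qed.

Lemma shift_sub A : shift A = subst (sub 0 (Var 1) 2) A.
Proof.
  unfold shift. f_equal. extensionality x.
  destruct x; [reflexivity|]. cbn. f_equal. lia.
Qed.

Lemma inst_sub t A : inst t A = subst (sub 0 t 0) A.
Proof.
  unfold inst. f_equal. extensionality x.
  destruct x; [reflexivity|]. cbn. f_equal. lia.
Qed.

Lemma succ_sub A :
  subst (fun x => match x with 0 => Succ (Var 0) | S x => Var (S x) end) A =
  subst (sub 0 (Succ (Var 0)) 1) A.
Proof.
  f_equal. extensionality x. destruct x; [reflexivity|]. cbn. f_equal. lia.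
Qed.

Definition TSubst (d u c a b : nat) : Prop :=
  exists s t, u = tcode s /\ a = tcode t /\ b = tcode (tsubst (sub d s c) t).

Definition ts_ax (x : nat) : Prop :=
  exists d u c, is_term u /\
    (x = quintuple d u c czero czero \/
     x = quintuple d u c (cvar d) u \/
     exists v,
       (v < d /\ x = quintuple d u c (cvar v) (cvar v)) \/
       (d <= v /\ x = quintuple d u c (cvar (S v)) (cvar (v + c)))).
Definition ts_rule (x y z : nat) : Prop :=
  exists d u c a a' b b',
    y = quintuple d u c a a' /\ z = quintuple d u c b b' /\
    (x = quintuple d u c (csucc a) (csucc a') \/
     x = quintuple d u c (cplus a b) (cplus a' b') \/
     x = quintuple d u c (cmult a b) (cmult a' b')).

Lemma TSubst_closure d u c a b :
  TSubst d u c a b <-> closure ts_ax ts_rule (quintuple d u c a b).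
Proof.
  split.
  - intros (s & t & -> & -> & ->).
    assert (Hs : is_term (tcode s)) by (apply is_term_spec; eauto).
    induction t as [x| |t IH|t1 IH1 t2 IH2|t1 IH1 t2 IH2]; cbn [tcode tsubst].
    + apply closure_ax. exists d, (tcode s), c. split; [exact Hs|]. unfold sub.
      destruct (Nat.ltb_spec x d); [right; right; exists x; left; auto|].
      destruct (Nat.eqb_spec x d) as [->|]; [right; left; auto|].
      right; right. exists (x - 1). right. split; [lia|].
      replace (S (x - 1)) with x by lia. reflexivity.
    + apply closure_ax. exists d, (tcode s), c. auto.
    + apply (closure_rule _ _ _ _ _ IH IH). do 7 eexists. eauto.
    + apply (closure_rule _ _ _ _ _ IH1 IH2). do 7 eexists. eauto.
    + apply (closure_rule _ _ _ _ _ IH1 IH2). do 7 eexists. eauto.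
  - intros H.
    enough (K : forall x, closure ts_ax ts_rule x ->
              exists d s c t,
                x = quintuple d (tcode s) c (tcode t) (tcode (tsubst (sub d s c) t))).
    { destruct (K _ H) as (d' & s & c' & t & E). inj. subst. now exists s, t. }
    clear. induction 1 as [x (d & u & c & Hu & Hx)
                          |x y z _ (d & s & c & t1 & ->) _ (d' & s' & c' & t2 & ->)
                           (d'' & u & c'' & a & a' & b & b' & E & E' & [->|[->| ->]])].
    + apply is_term_spec in Hu. destruct Hu as [s ->].
      destruct Hx as [->|[->|(v & [[Hv ->]|[Hv ->]])]].
      * now exists d, s, c, Zero.
      * exists d, s, c, (Var d). cbn [tsubst]. unfold sub.
        now rewrite Nat.ltb_irrefl, Nat.eqb_refl.
      * exists d, s, c, (Var v). cbn [tsubst]. unfold sub.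
        now rewrite (proj2 (Nat.ltb_lt v d) Hv).
      * exists d, s, c, (Var (S v)). cbn [tsubst]. unfold sub.
        destruct (Nat.ltb_spec (S v) d); [lia|].
        destruct (Nat.eqb_spec (S v) d); [lia|].
        now replace (S v - 1 + c) with (v + c) by lia.
    + codes_inj. do 3 eexists; now exists (Succ t1).
    + codes_inj. do 3 eexists; now exists (Plus t1 t2).
    + codes_inj. do 3 eexists; now exists (Mult t1 t2).
Qed.

Lemma def1_TSubst f1 f2 f3 f4 f5 :
  Fun1 f1 -> Fun1 f2 -> Fun1 f3 -> Fun1 f4 -> Fun1 f5 ->
  Def1 (fun r => TSubst (f1 r) (f2 r) (f3 r) (f4 r) (f5 r)).
Proof.
  intros. eapply def1_ext; [|intros r; symmetry; apply TSubst_closure].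
  apply (def1_closure (fun _ => ts_ax) (fun _ => ts_rule)).
  - unfold ts_ax. def1_syntax.
  - unfold ts_rule. def1.
  - repeat apply fun1_pair; assumption.
Qed.

Definition Subst (d u c a b : nat) : Prop :=
  exists s A, u = tcode s /\ a = code A /\ b = code (subst (sub d s c) A).

Definition s_ax (x : nat) : Prop :=
  exists d u c, is_term u /\
    (x = quintuple d u c cbot cbot \/
     exists a a' b b', TSubst d u c a a' /\ TSubst d u c b b' /\
       x = quintuple d u c (ceq a b) (ceq a' b')).
Definition s_rule (x y z : nat) : Prop :=
  exists d u u' c a a' b b',
    (y = quintuple d u c a a' /\ z = quintuple d u c b b' /\
     x = quintuple d u c (cimp a b) (cimp a' b')) \/
    (TSubst 0 (cvar 1) 2 u u' /\ y = quintuple (S d) u' c a a' /\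
     x = quintuple d u c (call a) (call a')).

Lemma Subst_closure d u c a b :
  Subst d u c a b <-> closure s_ax s_rule (quintuple d u c a b).
Proof.
  split.
  - intros (s & A & -> & -> & ->). revert d s.
    induction A as [t1 t2| |A IHA B IHB|A IH]; intros d s; cbn [code subst].
    + apply closure_ax. exists d, (tcode s), c. split; [apply is_term_spec; eauto|].
      right. do 4 eexists. repeat split; do 2 eexists; eauto.
    + apply closure_ax. exists d, (tcode s), c. split; [apply is_term_spec; eauto|].
      auto.
    + apply (closure_rule _ _ _ _ _ (IHA d s) (IHB d s)).
      exists d, (tcode s), 0, c. do 4 eexists. left. eauto.
    + rewrite up_sub.
      apply (closure_rule _ _ _ _ _ (IH (S d) (tshift s)) (IH (S d) (tshift s))).
      exists d, (tcode s), (tcode (tshift s)), c, (code A).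
      eexists. exists 0, 0. right. split; [|eauto].
      rewrite tshift_sub. now exists (Var 1), s.
  - intros H.
    enough (K : forall x, closure s_ax s_rule x ->
              exists d s c A,
                x = quintuple d (tcode s) c (code A) (code (subst (sub d s c) A))).
    { destruct (K _ H) as (d' & s & c' & A & E). inj. subst. now exists s, A. }
    clear. induction 1 as [x (d & u & c & Hu & Hx)
                          |x y z _ (d & s & c & A & ->) _ (d' & s' & c' & B & ->) HR].
    + apply is_term_spec in Hu. destruct Hu as [s ->].
      destruct Hx as [->|(a & a' & b & b' & (s1 & t1 & E1 & -> & ->)
                                          & (s2 & t2 & E2 & -> & ->) & ->)].
      * now exists d, s, c, Bot.
      * codes_inj. do 3 eexists; now exists (Eq t1 t2).
    + destruct HR as (e & u & u' & c'' & a & a' & b & b' &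
        [(E & E' & ->)|((s1 & t1 & E1 & -> & ->) & E2 & ->)]).
      * codes_inj. do 3 eexists; now exists (Imp A B).
      * change (cvar 1) with (tcode (Var 1)) in E1. codes_inj.
        do 3 eexists; exists (All A). cbn [subst code].
        now rewrite up_sub, tshift_sub.
Qed.

Lemma def1_Subst f1 f2 f3 f4 f5 :
  Fun1 f1 -> Fun1 f2 -> Fun1 f3 -> Fun1 f4 -> Fun1 f5 ->
  Def1 (fun r => Subst (f1 r) (f2 r) (f3 r) (f4 r) (f5 r)).
Proof.
  intros. eapply def1_ext; [|intros r; symmetry; apply Subst_closure].
  apply (def1_closure (fun _ => s_ax) (fun _ => s_rule)).
  - unfold s_ax. def1_syntax; apply def1_TSubst; def1.
  - unfold s_rule. def1_syntax; apply def1_TSubst; def1.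
  - repeat apply fun1_pair; assumption.
Qed.

(** ** Provability *)

Definition log_code (x : nat) : Prop :=
  (exists a b, is_form a /\ is_form b /\ x = cimp a (cimp b a)) \/
  (exists a b c, is_form a /\ is_form b /\ is_form c /\
     x = cimp (cimp a (cimp b c)) (cimp (cimp a b) (cimp a c))) \/
  (exists a, is_form a /\ x = cimp (cneg (cneg a)) a) \/
  (exists a b, is_form a /\ is_form b /\
     x = cimp (call (cimp a b)) (cimp (call a) (call b))) \/
  (exists a b, Subst 0 (cvar 1) 2 a b /\ x = cimp a (call b)) \/
  (exists a t b, Subst 0 t 0 a b /\ x = cimp (call a) b) \/
  (exists t, is_term t /\ x = ceq t t) \/
  (exists a s t b c, Subst 0 s 0 a b /\ Subst 0 t 0 a c /\
     x = cimp (ceq s t) (cimp b c)).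

Lemma def1_log_code f : Fun1 f -> Def1 (fun r => log_code (f r)).
Proof. apply def1_rel1. unfold log_code. def1_syntax; apply def1_Subst; def1. Qed.

Lemma codes_logical x : codes logical x <-> log_code x.
Proof.
  assert (HF : forall A, is_form (code A)) by (intros A; apply is_form_spec; eauto).
  assert (HT : forall t, is_term (tcode t)) by (intros t; apply is_term_spec; eauto).
  unfold log_code. split.
  - intros (A & HA & <-). destruct HA as [A B|A B C|A|A B|A|A t|t|A s t]; cbn [code Neg].
    + left. exists (code A), (code B). auto.
    + right; left. exists (code A), (code B), (code C). auto.
    + do 2 right; left. exists (code A). auto.
    + do 3 right; left. exists (code A), (code B). auto.
    + do 4 right; left. exists (code A), (code (shift A)). split; [|auto].
      rewrite shift_sub. now exists (Var 1), A.
    + do 5 right; left. exists (code A), (tcode t), (code (inst t A)).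
      split; [|auto]. rewrite inst_sub. now exists t, A.
    + do 6 right; left. exists (tcode t). auto.
    + do 7 right. exists (code A), (tcode s), (tcode t), (code (inst s A)), (code (inst t A)).
      rewrite !inst_sub. repeat split; [now exists s, A|now exists t, A].
  - intros H. repeat match type of H with _ \/ _ => destruct H as [H|H] end;
      decompose [ex and] H; clear H;
      repeat match goal with
      | H : is_form _ |- _ => apply is_form_spec in H; destruct H; subst
      | H : is_term _ |- _ => apply is_term_spec in H; destruct H; subst
      end.
    + eexists. split; [apply log_K|reflexivity].
    + eexists. split; [apply log_S|reflexivity].
    + eexists. split; [apply log_dn|reflexivity].
    + eexists. split; [apply log_dist|reflexivity].
    + match goal with H : Subst _ _ _ _ _ |- _ => destruct H as (s & A & E & -> & ->) end.
      change (cvar 1) with (tcode (Var 1)) in E. codes_inj.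
      rewrite <- shift_sub. eexists. split; [apply log_vac|reflexivity].
    + match goal with H : Subst _ _ _ _ _ |- _ => destruct H as (s & A & -> & -> & ->) end.
      subst x. rewrite <- inst_sub. eexists. split; [apply log_inst|reflexivity].
    + eexists. split; [apply log_refl|reflexivity].
    + repeat match goal with
      | H : Subst _ _ _ _ _ |- _ => destruct H as (? & ? & ? & ? & ?)
      end. codes_inj.
      rewrite <- !inst_sub. eexists. split; [apply log_leib|reflexivity].
Qed.

Definition hil_rule (x y z : nat) : Prop := y = cimp z x \/ x = call y.

Lemma codes_hilbert T x :
  codes (hilbert T) x <->
  closure (fun a => codes T a \/ log_code a) hil_rule x.
Proof.
  split.
  - intros (A & HA & <-). induction HA as [A HA|A HA|A B _ IH1 _ IH2|A _ IH].
    + apply closure_ax. left. now exists A.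
    + apply closure_ax. right. apply codes_logical. now exists A.
    + apply (closure_rule _ _ _ _ _ IH1 IH2). now left.
    + apply (closure_rule _ _ _ _ _ IH IH). now right.
  - induction 1 as [x Hx|x y z _ (A & HA & <-) _ (B & HB & <-) [E| ->]].
    + destruct Hx as [(A & HA & <-)|Hx].
      * exists A. split; [now apply hil_ax|reflexivity].
      * apply codes_logical in Hx. destruct Hx as (A & HA & <-).
        exists A. split; [now apply hil_log|reflexivity].
    + apply code_imp_inv in E. destruct E as (B' & C & -> & E & <-).
      apply code_inj in E. subst B'. exists C. split; [|reflexivity].
      eapply hil_mp; eassumption.
    + exists (All A). split; [now apply hil_gen|reflexivity].
Qed.

(** The parameters on which the axioms of [T] depend are passed through the
    environment. *)
Lemma def1_hilbert (T : (nat -> nat) -> form -> Prop) f :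
  Def1 (fun r => codes (T (tail r)) (r 0)) -> Fun1 f ->
  Def1 (fun r => codes (hilbert (T r)) (f r)).
Proof.
  intros HT Hf. eapply def1_ext; [|intros r; symmetry; apply codes_hilbert].
  apply (def1_closure (fun r a => codes (T r) a \/ log_code a) (fun _ => hil_rule));
    [| |exact Hf].
  - apply def1_or; [exact HT|apply def1_log_code; def1].
  - unfold hil_rule. def1.
Qed.

(** ** The axioms of Peano Arithmetic *)

Definition ind_ax (x : nat) : Prop :=
  exists a b c, Subst 0 czero 0 a b /\ Subst 0 (csucc (cvar 0)) 1 a c /\
    x = cimp b (cimp (call (cimp a c)) (call a)).
Definition all_rule (x y z : nat) : Prop := x = call y.

Lemma induction_closure x :
  (exists m A, x = code (Nat.iter m All (induction A))) <->
  closure ind_ax all_rule x.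
Proof.
  split.
  - intros (m & A & ->). induction m as [|m IH].
    + apply closure_ax. cbn [Nat.iter nat_rect code induction].
      do 3 eexists. split; [|split; [|reflexivity]].
      * rewrite inst_sub. now exists Zero, A.
      * rewrite succ_sub. now exists (Succ (Var 0)), A.
    + exact (closure_rule _ _ _ _ _ IH IH eq_refl).
  - induction 1 as [x (a & b & c & (s & A & E1 & -> & ->) & (t & A' & E2 & E & ->) & ->)
                   |x y z _ (m & A & ->) _ _ ->].
    + change czero with (tcode Zero) in E1.
      change (csucc (cvar 0)) with (tcode (Succ (Var 0))) in E2. codes_inj.
      exists 0, A'. cbn [Nat.iter nat_rect]. unfold induction.
      now rewrite inst_sub, succ_sub.
    + now exists (S m), A.
Qed.

(** The constants are the codes of the six single axioms. *)
Lemma codes_PA :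
  exists c1 c2 c3 c4 c5 c6, forall x, codes PA x <->
    x = c1 \/ x = c2 \/ x = c3 \/ x = c4 \/ x = c5 \/ x = c6 \/
    (Bounded 0 x /\ closure ind_ax all_rule x).
Proof.
  do 6 eexists. intros x. split.
  - intros (A & HA & <-). destruct HA as [| | | | | |A m HA];
      [do 0 right|do 1 right|do 2 right|do 3 right|do 4 right|do 5 right|do 6 right];
      try (left; reflexivity).
    split; [eexists; split; [exact HA|reflexivity]|].
    apply induction_closure. eauto.
  - intros [->|[->|[->|[->|[->|[->|[(A & HA & ->) K]]]]]]].
    + eexists. split; [apply PA_succ_nonzero|reflexivity].
    + eexists. split; [apply PA_succ_inj|reflexivity].
    + eexists. split; [apply PA_plus_zero|reflexivity].
    + eexists. split; [apply PA_plus_succ|reflexivity].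
    + eexists. split; [apply PA_mult_zero|reflexivity].
    + eexists. split; [apply PA_mult_succ|reflexivity].
    + apply induction_closure in K. destruct K as (m & B & E).
      apply code_inj in E. subst A. eexists. split; [apply PA_induction, HA|reflexivity].
Qed.

Lemma def1_PA f : Fun1 f -> Def1 (fun r => codes PA (f r)).
Proof.
  apply def1_rel1. destruct codes_PA as (c1 & c2 & c3 & c4 & c5 & c6 & H).
  eapply def1_ext; [|intros r; symmetry; apply H].
  def1_syntax. apply (def1_closure (fun _ => ind_ax) (fun _ => all_rule)).
  - unfold ind_ax. def1_syntax; apply def1_Subst; def1.
  - unfold all_rule. def1.
  - def1.
Qed.

Lemma fun1_num f : Fun1 f -> Fun1 (fun r => tcode (num (f r))).
Proof.
  apply (fun1_comp1 (fun n => tcode (num n))). unfold Fun1, tail.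
  set (Ax (x : nat) := x = to_nat (0, czero)).
  set (Rule (x y z : nat) := exists n a, y = to_nat (n, a) /\ x = to_nat (S n, csucc a)).
  apply (def1_ext (fun r => closure Ax Rule (to_nat (r 1, r 0)))).
  - apply (def1_closure (fun _ => Ax) (fun _ => Rule)); unfold Ax, Rule; def1.
  - intros r. split.
    + enough (K : forall x, closure Ax Rule x -> exists n, x = to_nat (n, tcode (num n))).
      { intros H. destruct (K _ H) as [n E]. inj. now subst. }
      induction 1 as [x ->|x y z _ [n ->] _ _ (n' & a & E & ->)].
      * now exists 0.
      * inj. subst. now exists (S n').
    + intros ->. induction (r 1) as [|n IH].
      * apply closure_ax. reflexivity.
      * apply (closure_rule _ _ _ _ _ IH IH). now exists n, (tcode (num n)).
Qed.

(** * A self-referential family of sentences *)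

Lemma least (P : nat -> Prop) :
  (exists n, P n) -> exists n, P n /\ forall m, P m -> n <= m.
Proof.
  intros [n Hn]. apply NNPP. intros H. revert Hn.
  induction n as [n IH] using lt_wf_ind. intros Hn. apply H.
  exists n. split; [exact Hn|]. intros m Hm.
  destruct (Nat.le_gt_cases n m) as [|Hlt]; [assumption|].
  destruct (IH m Hlt Hm).
Qed.

(** A defining formula obtained from closure properties comes without a bound on
    its free variables, which are therefore cut down by force. *)
Definition restrict (k : nat) (A : form) : form :=
  subst (fun i => if i <? k then Var i else Zero) A.

Lemma tbounded_subst k l f t :
  tbounded k t -> (forall i, i < k -> tbounded l (f i)) -> tbounded l (tsubst f t).
Proof. intros Ht Hf. induction t; simpl in *; intuition auto. Qed.

Lemma bounded_subst A : forall k l f,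
  bounded k A -> (forall i, i < k -> tbounded l (f i)) -> bounded l (subst f A).
Proof.
  induction A as [s t| |A IHA B IHB|A IH]; simpl; intros k l f HA Hf.
  - destruct HA. split; eapply tbounded_subst; eassumption.
  - exact I.
  - destruct HA. split; eauto.
  - apply (IH (S k)); [exact HA|]. intros [|i] Hi; simpl; [lia|].
    apply (tbounded_subst l); [apply Hf; lia|]. intros j Hj. simpl. lia.
Qed.

Lemma bounded_restrict k A : bounded k (restrict k A).
Proof.
  destruct (proj2 (is_form_spec _) (ex_intro _ A eq_refl)) as (m & A' & HA & E).
  apply code_inj in E. subst A'.
  apply (bounded_subst _ m); [exact HA|]. intros i _.
  destruct (Nat.ltb_spec i k); simpl; auto.
Qed.

(** The last argument of [F] is its own code, which is how [F] refers to itself.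
    The variables from 3 on do not occur in the formulas considered, whence the
    quantifier over [r]. *)
Definition stage (F : form) (s l : nat) : Prop :=
  forall r, sat (scons s (scons l (scons (code F) r))) F.

Definition selects (F : form) (l : nat) : Prop := exists s, stage F s l.

(** Uniformization of [P]: the formula picks the least [s] that bounds both a
    value [l] and a witness for [P e l], and for this [s] the least such [l]. *)
Lemma selector (P : nat -> nat -> Prop) :
  Def1 (fun r => P (r 0) (r 1)) ->
  exists F, Delta0 F /\ bounded 3 F /\
    (forall r s l, sat (scons s (scons l (scons (code F) r))) F -> stage F s l) /\
    (forall l l', selects F l -> selects F l' -> l = l') /\
    (forall l, selects F l -> P (code F) l) /\
    (forall l, P (code F) l -> exists l', selects F l').
Proof.
  intros (R & HR & H).
  (* Arbitrary values for the variables on which [P] does not depend. *)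
  set (z := fun _ : nat => 0).
  set (Q s l e := exists w, w <= s /\ R (scons w (scons e (scons l z)))).
  set (first s l e := l <= s /\ Q s l e /\
    forall s', s' <= s -> forall l', l' <= s' -> Q s' l' e -> s' = s /\ l <= l').
  assert (HQ : forall i j k, Def0 (fun r => Q (r i) (r j) (r k))).
  { intros i j k. apply (def0_bex (fun r => r i)
      (fun r w => R (scons w (scons (r k) (scons (r j) z))))); [apply poly_var|].
    destruct HR as (A & HA & HR).
    exists (subst (fun x => match x with
                            | 0 => Var 0 | 1 => Var (S k) | 2 => Var (S j) | _ => Zero
                            end) A).
    split; [now apply Delta0_subst|]. intros r. rewrite sat_subst, HR.
    match goal with |- R ?a <-> R ?b => replace a with b; [tauto|] end.
    extensionality x. now destruct x as [|[|[|x]]]. }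
  assert (HD : Def0 (fun r => first (r 0) (r 1) (r 2))).
  { apply def0_and; [apply def0_le; apply poly_var|]. apply def0_and; [apply HQ|].
    apply (def0_ball (fun r => r 0) (fun r s' => forall l', l' <= s' ->
       Q s' l' (r 2) -> s' = r 0 /\ r 1 <= l')); [apply poly_var|].
    apply (def0_ball (fun r => r 0) (fun r l' =>
       Q (r 0) l' (r 3) -> r 0 = r 1 /\ r 2 <= l')); [apply poly_var|].
    apply def0_imp; [exact (HQ 1 0 4)|].
    apply def0_and; [apply def0_eq|apply def0_le]; apply poly_var. }
  destruct HD as (A & HA & HD).
  assert (HF : forall r, sat r (restrict 3 A) <-> first (r 0) (r 1) (r 2)).
  { intros r. unfold restrict. rewrite sat_subst, HD. reflexivity. }
  exists (restrict 3 A). set (F := restrict 3 A) in *.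
  assert (HS : forall s l, stage F s l <-> first s l (code F)).
  { intros s l. split; [intros K; exact (proj1 (HF _) (K z))|].
    intros K r. apply HF. exact K. }
  split; [now apply Delta0_subst|]. split; [apply bounded_restrict|].
  split; [|split; [|split]].
  - intros r s l K. apply HS. exact (proj1 (HF _) K).
  - intros l l' [s K] [s' K']. apply HS in K, K'.
    destruct K as (K1 & K2 & K3), K' as (K1' & K2' & K3').
    destruct (Nat.le_ge_cases s s') as [L|L].
    + destruct (K3' s L l K1 K2) as [-> Hl].
      destruct (K3 s' L l' K1' K2') as [_ Hl']. lia.
    + destruct (K3 s' L l' K1' K2') as [-> Hl'].
      destruct (K3' s (le_n _) l K1 K2) as [_ Hl]. lia.
  - intros l [s K]. apply HS in K. destruct K as (_ & (w & _ & Hw) & _).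
    apply (H (scons (code F) (scons l z))). eauto.
  - intros l Hl. apply (H (scons (code F) (scons l z))) in Hl. destruct Hl as [w Hw].
    destruct (least (fun s => exists l, l <= s /\ Q s l (code F)))
      as (s & (l' & Hl' & Hs) & Hmin).
    { exists (w + l), l. split; [lia|]. exists w. split; [lia|exact Hw]. }
    destruct (least (fun l => l <= s /\ Q s l (code F))) as (m & [Hm Hm'] & Hmin');
      [eauto|].
    exists m, s. apply HS. split; [exact Hm|]. split; [exact Hm'|].
    intros s' Hs' k Hk HQ'. assert (s <= s') by (apply Hmin; eauto).
    assert (s' = s) by lia. subst s'. auto.
Qed.

(** In the standard model the first sentence says that [F] does not select [l] and
    the second that [F] selects a value other than [l] ([sat_claim]). The numerals
    enter through equations instead of being substituted, so that the code of a
    claim is an explicit function of [code F] and [l]. *)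
Definition claim (D : side) (F : form) (l : nat) : form :=
  match D with
  | Pi => All (All (All
      (Imp (Eq (Var 2) (num (code F))) (Imp (Eq (Var 1) (num l)) (Neg F)))))
  | Sigma => Ex (Ex (Ex
      (Neg (Imp (Eq (Var 2) (num (code F)))
                (Imp (Neg (Eq (Var 1) (num l))) (Neg F))))))
  end.

Lemma tbounded_num k n : tbounded k (num n).
Proof. induction n; simpl; auto. Qed.

Lemma sentence_claim D F l : bounded 3 F -> sentence (claim D F l).
Proof.
  intros HF. pose proof (tbounded_num 3 (code F)). pose proof (tbounded_num 3 l).
  unfold sentence, claim, Ex, Neg. destruct D; cbn [bounded tbounded];
    repeat split; auto.
Qed.

Lemma prenex_succ D n A : prenex D n A -> prenex D (S n) A.
Proof.
  induction 1.
  - now apply prenex_dual, prenex_Delta0.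
  - now apply prenex_dual.
  - now apply prenex_ex.
  - now apply prenex_all.
Qed.

Lemma prenex_claim D F l n : Delta0 F -> 1 <= n -> prenex D n (claim D F l).
Proof.
  intros HF Hn. induction Hn as [|n _ IH]; [|now apply prenex_succ].
  unfold claim. destruct D.
  - do 3 apply prenex_ex. apply prenex_dual, prenex_Delta0. repeat constructor. exact HF.
  - do 3 apply prenex_all. apply prenex_dual, prenex_Delta0. repeat constructor. exact HF.
Qed.

Definition claim_code (D : side) (e l : nat) : nat :=
  match D with
  | Pi => call (call (call
      (cimp (ceq (cvar 2) (tcode (num e))) (cimp (ceq (cvar 1) (tcode (num l))) (cneg e)))))
  | Sigma =>
      let cex a := cneg (call (cneg a)) in
      cex (cex (cex (cneg
        (cimp (ceq (cvar 2) (tcode (num e)))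
              (cimp (cneg (ceq (cvar 1) (tcode (num l)))) (cneg e))))))
  end.

Lemma code_claim D F l : code (claim D F l) = claim_code D (code F) l.
Proof. now destruct D. Qed.

Lemma fun1_claim_code D f g : Fun1 f -> Fun1 g -> Fun1 (fun r => claim_code D (f r) (g r)).
Proof.
  intros Hf Hg. apply fun1_num in Hf as Hf'. apply fun1_num in Hg as Hg'.
  unfold claim_code. destruct D; cbv zeta; def1; assumption.
Qed.

Definition all_but (D : side) (F : form) (k : nat) (B : form) : Prop :=
  PA B \/ (exists l, l <> k /\ B = claim D F l) \/ B = Neg (claim D F k).

Definition refuted (D : side) (e k : nat) : Prop :=
  exists F, e = code F /\ hilbert (all_but D F k) Bot.

(** [T] below describes [all_but] by codes alone, so that its dependence on the
    two parameters is visible. *)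
Lemma def1_refuted D : Def1 (fun r => refuted D (r 0) (r 1)).
Proof.
  set (T := fun r B => is_form (r 0) /\ (PA B \/
    (exists l, l <> r 1 /\ code B = claim_code D (r 0) l) \/
    code B = cneg (claim_code D (r 0) (r 1)))).
  assert (HT : forall F k r B,
    T (scons (code F) (scons k r)) B <-> all_but D F k B).
  { intros F k r B. unfold T, all_but. cbn [scons]. split.
    - intros (_ & [K|[(l & Hl & E)|E]]); [auto|right; left; exists l|right; right].
      + split; [exact Hl|]. apply code_inj. now rewrite code_claim.
      + apply code_inj. cbn [code Neg]. now rewrite code_claim.
    - intros K. split; [apply is_form_spec; eauto|].
      destruct K as [K|[(l & Hl & ->)| ->]]; [auto|right; left; exists l|right; right].
      + now rewrite code_claim.
      + cbn [code Neg]. now rewrite code_claim. }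
  apply (def1_ext (fun r => is_form (r 0) /\ codes (hilbert (T r)) cbot)).
  - apply def1_and; [def1_syntax|]. apply def1_hilbert; [|def1].
    apply (def1_ext (fun r => is_form (r 1) /\ (codes PA (r 0) \/
      is_form (r 0) /\ ((exists l, l <> r 2 /\ r 0 = claim_code D (r 1) l) \/
      r 0 = cneg (claim_code D (r 1) (r 2)))))).
    + apply def1_and; [def1_syntax|]. apply def1_or; [apply def1_PA; def1|].
      apply def1_and; [def1_syntax|]. def1; apply fun1_claim_code; def1.
    + intros r. unfold T, tail. split.
      * intros (H & [(B & HB & <-)|(H' & K)]); [exists B; auto|].
        apply is_form_spec in H'. destruct H' as [B E]. exists B. rewrite <- E. auto.
      * intros (B & (H & K) & <-). split; [exact H|].
        destruct K as [K|K]; [left; now exists B|right]. 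
        split; [apply is_form_spec; eauto|exact K].
  - intros r. rewrite <- (scons_tail r) , <- (scons_tail (tail r)).
    generalize (r 0) (tail r 0) (tail (tail r)). intros e k r'. cbn [scons].
    unfold refuted. split.
    + intros [H (B & HB & E)]. apply is_form_spec in H. destruct H as [F ->].
      exists F. split; [reflexivity|].
      change cbot with (code Bot) in E. apply code_inj in E. subst B.
      assert (ET : T (scons (code F) (scons k r')) = all_but D F k).
      { extensionality B. apply propositional_extensionality. apply HT. }
      now rewrite <- ET.
    + intros (F & -> & H). split; [apply is_form_spec; eauto|].
      exists Bot. split; [|reflexivity].
      assert (ET : T (scons (code F) (scons k r')) = all_but D F k).
      { extensionality B. apply propositional_extensionality. apply HT. }
      now rewrite ET.
Qed.

Lemma sat_claim D F l r :
  (forall r s l, sat (scons s (scons l (scons (code F) r))) F -> stage F s l) ->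
  sat r (claim D F l) <->
  match D with
  | Pi => ~ selects F l
  | Sigma => exists l', l' <> l /\ selects F l'
  end.
Proof.
  intros HF. destruct D; unfold claim; rewrite ?sat_ex; cbn [sat Neg ev scons].
  - split.
    + intros [e H]. rewrite sat_ex in H. destruct H as [l' H].
      rewrite sat_ex in H. destruct H as [s H]. cbn [sat Neg ev scons] in H.
      rewrite !ev_num in H. apply NNPP. intros N. apply H. intros -> Hl K.
      apply N. exists l'. split; [exact Hl|]. exists s. exact (HF _ _ _ K).
    + intros (l' & Hl & s & K). exists (code F). rewrite sat_ex. exists l'.
      rewrite sat_ex. exists s. cbn [sat Neg ev scons]. rewrite !ev_num.
      intros N. exact (N eq_refl Hl (K r)).
  - split.
    + intros H [s K]. specialize (H (code F) l s). rewrite !ev_num in H.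
      exact (H eq_refl eq_refl (K r)).
    + intros H e l' s. rewrite !ev_num. intros -> -> K. apply H.
      exists s. exact (HF _ _ _ K).
Qed.

(** If one of the theories were inconsistent, [F] would select some inconsistent
    [all_but D F l]. The [l]-th claim would then be the only false one, so that
    this theory would be true in the standard model. *)
Theorem independent_claims D :
  exists F, Delta0 F /\ bounded 3 F /\ forall k, ~ proves (all_but D F k) Bot.
Proof.
  destruct (selector _ (def1_refuted D)) as (F & HF & HB & Hstage & Huniq & Href & Hsel).
  exists F. split; [exact HF|]. split; [exact HB|]. intros k Hk.
  apply proves_hilbert in Hk.
  destruct (Hsel k) as [l Hl]; [now exists F|].
  destruct (Href l Hl) as (F' & E & H). apply code_inj in E. subst F'.
  apply (sat_hilbert (all_but D F l) Bot) with (r := fun _ => 0) in H; [exact H|].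
  intros B r [HPA|[(l' & Hl' & ->)| ->]].
  - now apply sat_PA.
  - rewrite sat_claim by exact Hstage. destruct D; [eauto|].
    intros K. apply Hl'. eauto.
  - rewrite sat_neg, sat_claim by exact Hstage. destruct D; [|tauto].
    intros (l' & Hl' & K). apply Hl'. eauto.
Qed.

(** * Derivations in natural deduction *)

Lemma nd_weaken L A : nd L A -> forall L', incl L L' -> nd L' A.
Proof.
  induction 1 as [L A H|L A B _ IH|L A B _ IH1 _ IH2|L A _ IH|L A _ IH
                 |L A t _ IH|L t|L A s t _ IH1 _ IH2]; intros L' HL.
  - apply nd_hyp, HL, H.
  - apply nd_impI, IH. intros C [->|HC]; [now left|right; auto].
  - apply (nd_impE _ A); auto.
  - apply nd_raa, IH. intros C [->|HC]; [now left|right; auto].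
  - apply nd_allI, IH. now apply incl_map.
  - apply nd_allE; auto.
  - apply nd_refl.
  - apply (nd_leibniz _ _ s); auto.
Qed.

Lemma nd_botE L A : nd L Bot -> nd L A.
Proof. intros H. apply nd_raa, (nd_weaken L); [exact H|]. intros C; now right. Qed.

Lemma nd_and L A B : nd L A -> nd L B -> nd L (And A B).
Proof.
  intros HA HB. apply nd_impI.
  apply (nd_impE _ B); [|apply (nd_weaken L); [exact HB|intros C; now right]].
  apply (nd_impE _ A); [apply nd_hyp; now left|].
  apply (nd_weaken L); [exact HA|intros C; now right].
Qed.

Lemma subst_comp A : forall f g,
  subst g (subst f A) = subst (fun x => tsubst g (f x)) A.
Proof.
  induction A as [s t| |A IHA B IHB|A IH]; intros f g; simpl.
  - now rewrite !tsubst_comp.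
  - reflexivity.
  - now rewrite IHA, IHB.
  - rewrite IH. f_equal. f_equal. extensionality x. destruct x; [reflexivity|].
    apply tsubst_up_tshift.
Qed.

Lemma tsubst_id t : tsubst Var t = t.
Proof. induction t; simpl; congruence. Qed.

Lemma subst_id A : subst Var A = A.
Proof.
  induction A as [s t| |A IHA B IHB|A IH]; simpl; rewrite ?tsubst_id; try congruence.
  replace (up Var) with Var; [congruence|]. extensionality x. now destruct x.
Qed.

(** The freshly introduced variable instantiates a universal hypothesis. *)
Lemma nd_open L A : In (All A) L -> nd (map shift L) A.
Proof.
  intros H. apply (in_map shift) in H. apply nd_hyp in H.
  apply (nd_allE _ _ (Var 0)) in H. unfold inst in H. fold subst in H.
  rewrite subst_comp in H.
  replace (fun x => tsubst _ _) with Var in H; [now rewrite subst_id in H|].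
  extensionality x. now destruct x.
Qed.

(** Negation passes through the quantifier prefix. The equivalence is needed in
    every context, since the induction step uses it under a quantifier. *)
Lemma prenex_neg D n A :
  prenex D n A ->
  exists B, prenex (dual D) n B /\
    forall L, nd L (Imp (Neg A) B) /\ nd L (Imp B (Neg A)).
Proof.
  induction 1 as [D A HA|D n A _ (B & HB & H)|n A _ (B & HB & H)|n A _ (B & HB & H)].
  - exists (Neg A). split; [apply prenex_Delta0, Delta0_imp; [exact HA|apply Delta0_bot]|].
    intros L. split; apply nd_impI, nd_hyp; now left.
  - exists B. split; [now apply prenex_dual|exact H].
  - exists (All B). split; [now apply prenex_all|]. intros L. split.
    + apply nd_impI, (nd_impE _ (All (Neg A))).
      * apply nd_impI, nd_allI. apply (nd_impE _ (Neg A)); [apply H|].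
        apply nd_open. now left.
      * apply nd_raa. apply (nd_impE _ (Ex A)); apply nd_hyp; simpl; auto.
    + apply nd_impI, nd_impI. apply (nd_impE _ (All (Neg A))); [apply nd_hyp; now left|].
      apply nd_allI. apply (nd_impE _ B); [apply H|]. apply nd_open. simpl; auto.
  - exists (Ex B). split; [now apply prenex_ex|]. intros L. split.
    + apply nd_impI, nd_impI. apply (nd_impE _ (All A)); [apply nd_hyp; simpl; auto|].
      apply nd_allI, nd_raa. apply (nd_impE _ B).
      * apply (nd_weaken (map shift (All (Neg B) :: Neg (All A) :: L))).
        -- apply nd_open. now left.
        -- intros C HC. now right.
      * apply (nd_impE _ (Neg A)); [apply H|]. apply nd_hyp. now left.
    + apply nd_impI, nd_impI. apply (nd_impE _ (All (Neg B))); [apply nd_hyp; simpl; auto|].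
      apply nd_allI, nd_impI. apply (nd_impE _ A).
      * apply (nd_impE _ B); [apply H|]. apply nd_hyp. now left.
      * apply (nd_weaken (map shift (All A :: Ex B :: L))).
        -- apply nd_open. now left.
        -- intros C HC. now right.
Qed.

Lemma in_class_prenex D n A : prenex D n A -> in_class D n A.
Proof.
  intros H. exists A. split; [exact H|]. exists []. split; [intros B []|].
  apply nd_and; apply nd_impI, nd_hyp; now left.
Qed.

Lemma in_class_neg D n A : prenex D n A -> in_class (dual D) n (Neg A).
Proof.
  intros H. destruct (prenex_neg _ _ _ H) as (B & HB & K).
  exists B. split; [exact HB|]. exists []. split; [intros C []|].
  apply nd_and; apply K.
Qed.

Lemma proves_ax T A : T A -> proves T A.
Proof.
  intros H. exists [A]. split; [intros B [<-|[]]; exact H|]. apply nd_hyp. now left.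
Qed.

Lemma proves_impI T A B : proves (add_axiom T A) B -> proves T (Imp A B).
Proof.
  intros (L & HL & H).
  enough (exists L', (forall C, In C L' -> T C) /\ incl L (A :: L')) as (L' & HL' & Hi).
  { exists L'. split; [exact HL'|]. now apply nd_impI, (nd_weaken L). }
  clear H. induction L as [|C L IH]; [exists []; split; intros C []|].
  destruct IH as (L' & HL' & Hi); [intros D HD; apply HL; now right|].
  destruct (HL C (or_introl eq_refl)) as [HC| ->].
  - exists (C :: L'). split; [intros D [<-|HD]; auto|].
    intros D [<-|HD]; [right; now left|].
    destruct (Hi D HD) as [<-|HD']; [now left|right; now right].
  - exists L'. split; [exact HL'|]. intros D [<-|HD]; [now left|auto].
Qed.

Lemma proves_mp T A B : proves T (Imp A B) -> proves T A -> proves T B.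
Proof.
  intros (L & HL & H) (L' & HL' & H'). exists (L ++ L'). split.
  - intros C HC. apply in_app_or in HC. destruct HC; auto.
  - apply (nd_impE _ A); eapply nd_weaken; eauto using incl_appl, incl_appr, incl_refl.
Qed.

Lemma proves_cut V T A :
  (forall B, V B -> proves T B) -> proves V A -> proves T A.
Proof.
  intros HS (L & HL & H). revert A H.
  induction L as [|B L IH]; intros A H.
  - exists []. split; [intros C []|exact H].
  - apply (proves_mp _ B); [|apply HS, HL; now left].
    apply IH; [intros C HC; apply HL; now right|]. now apply nd_impI.
Qed.

Lemma proves_raa T A : proves (add_axiom T (Neg A)) Bot -> proves T A.
Proof.
  intros H. apply proves_impI in H. destruct H as (L & HL & H).
  exists L. split; [exact HL|]. apply nd_raa.
  apply (nd_impE _ (Neg A)); [|apply nd_hyp; now left].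
  apply (nd_weaken L); [exact H|intros C; now right].
Qed.

Lemma proves_botE T A : proves T Bot -> proves T A.
Proof. intros (L & HL & H). exists L. split; [exact HL|now apply nd_botE]. Qed.

Lemma proves_add T A B : proves T B -> proves (add_axiom T A) B.
Proof. apply proves_cut. intros C HC. apply proves_ax. now left. Qed.

Lemma proves_added T A : proves (add_axiom T A) A.
Proof. apply proves_ax. now right. Qed.

(** * The family and its properties *)

Section Theories.
Context (X : nat -> form).

(** The axioms express, by one instance for each pair, that at most one of the
    sentences [X l] fails. *)
Definition almost_all (B : form) : Prop :=
  PA B \/ exists p q, p <> q /\ B = Imp (Neg (X p)) (X q).

Definition almost_all_from (j : nat) (B : form) : Prop :=
  almost_all B \/ exists l, j <= l /\ B = X l.

(** The theories of the family. The number [m] lets each pair of [A] and [b] recur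
    at arbitrarily large indices. The offset 2 keeps [X 0] and [X 1] out of the
    axioms: one of them has to fail for the last axiom to hold whatever [A] is. *)
Definition refuting (j : nat) (B : form) : Prop :=
  almost_all_from (2 + j) B \/
  exists A b m, sentence A /\ b <= 1 /\ j = to_nat (to_nat (code A, b), m) /\
    B = Imp A (Neg (X b)).

(** Each [X q] with [q] beyond the finitely many [X l] of a first proof follows
    from [Neg A], since a false [X q] makes those [X l] true; a second proof that
    uses only such [X q] then yields [A]. *)
Lemma almost_all_limit A :
  (forall j, proves (almost_all_from j) A) -> proves almost_all A.
Proof.
  intros H.
  assert (HN : exists N,
    proves (fun B => almost_all B \/ exists l, l < N /\ B = X l) A).
  { destruct (H 0) as (L & HL & HA).
    enough (exists N, forall B, In B L -> almost_all B \/ exists l, l < N /\ B = X l)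
      as [N HN] by (exists N, L; auto).
    clear HA. induction L as [|B L IH]; [exists 0; intros B []|].
    destruct IH as [N HN]; [intros C HC; apply HL; now right|].
    destruct (HL B (or_introl eq_refl)) as [HB|(l & _ & ->)].
    - exists N. intros C [<-|HC]; auto.
    - exists (S (N + l)). intros C [<-|HC]; [right; exists l; split; [lia|reflexivity]|].
      destruct (HN C HC) as [|(k & Hk & ->)]; [now left|].
      right. exists k. split; [lia|reflexivity]. }
  destruct HN as [N HN]. apply proves_raa.
  apply (proves_mp _ A); [apply proves_added|].
  apply (proves_cut (almost_all_from N)); [|apply H].
  intros B [HB|(q & Hq & ->)]; [apply proves_ax; now left|].
  apply proves_raa, (proves_mp _ A); [apply proves_add, proves_added|].
  apply (proves_cut _ _ _) with (2 := HN).
  intros B [HB|(l & Hl & ->)]; [apply proves_ax; left; now left|].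
  apply (proves_mp _ (Neg (X q))); [|apply proves_added].
  apply proves_ax. left. left. right. exists q, l. split; [lia|reflexivity].
Qed.

(** At an index coding [A] and [b], conservativity yields a proof of ~ X b that
    does not use [A]; its last axiom is harmless in the presence of ~ A. Doing
    this for both values of [b] contradicts ~ X 0 -> X 1. *)
Lemma conservative_almost_all G n A :
  (forall l, sentence (X l)) -> (forall l, in_class G n (Neg (X l))) ->
  sentence A -> (forall j, conservative G n (refuting j) A) -> proves almost_all A.
Proof.
  intros HX HG HA HC. apply almost_all_limit. intros j.
  apply proves_raa.
  assert (K : forall b, b <= 1 ->
            proves (add_axiom (almost_all_from j) (Neg A)) (Neg (X b))).
  { intros b Hb. set (i := to_nat (to_nat (code A, b), j)).
    assert (Hi : j <= i).
    { unfold i. pose proof (to_nat_spec (to_nat (code A, b)) j). lia. }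
    apply (proves_cut (refuting i)).
    - intros B [[HB|(l & Hl & ->)]|(A' & b' & m & _ & _ & E & ->)].
      + apply proves_ax. left. now left.
      + apply proves_ax. left. right. exists l. split; [lia|reflexivity].
      + unfold i in E. codes_inj. apply proves_impI, proves_botE.
        apply (proves_mp _ A'); [apply proves_add|]; apply proves_added.
    - apply (HC i); [split; [apply HX|exact I]|apply HG|].
      apply (proves_mp _ A); [|apply proves_added].
      apply proves_ax. left. right. exists A, b, j. auto. }
  apply (proves_mp _ (X 1)); [apply (K 1); lia|].
  apply (proves_mp _ (Neg (X 0))); [|apply (K 0); lia].
  apply proves_ax. left. left. right. exists 0, 1. split; [lia|reflexivity].
Qed.

End Theories.

Section Independent.
Context (D : side) (F : form).
Context (HB : bounded 3 F).
Context (Hcons : forall k, ~ proves (all_but D F k) Bot).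

Lemma almost_all_within_all_but k B : almost_all (claim D F) B -> proves (all_but D F k) B.
Proof.
  intros [HP|(p & q & Hpq & ->)]; [apply proves_ax; now left|].
  apply proves_impI. destruct (Nat.eq_dec q k) as [->|Hq].
  - apply proves_botE, (proves_mp _ (claim D F p)); [apply proves_added|].
    apply proves_add, proves_ax. right. left. eauto.
  - apply proves_add, proves_ax. right. left. eauto.
Qed.

(** If the last axiom of [refuting j] is A -> ~ X b, take [b] for [k]: then ~ X b
    is an axiom, so that it does not matter what [A] says. *)
Lemma refuting_within_all_but j :
  exists k, forall B, refuting (claim D F) j B -> proves (all_but D F k) B.
Proof.
  assert (Hk : exists k, k <= 1 /\ forall a b m,
            b <= 1 -> j = to_nat (to_nat (a, b), m) -> b = k).
  { destruct (classic (exists a b m, b <= 1 /\ j = to_nat (to_nat (a, b), m)))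
      as [(a & b & m & Hb & ->)|N].
    - exists b. split; [exact Hb|]. intros a' b' m' _ E. now inj.
    - exists 0. split; [lia|]. intros a b m Hb E. destruct N. eauto. }
  destruct Hk as (k & Hk & Huniq). exists k.
  intros B [[HA|(l & Hl & ->)]|(A & b & m & _ & Hb & E & ->)].
  - now apply almost_all_within_all_but.
  - apply proves_ax. right. left. exists l. split; [lia|reflexivity].
  - rewrite (Huniq _ _ _ Hb E). apply proves_impI, proves_add, proves_ax.
    right. now right.
Qed.

Lemma almost_all_unprovable k : ~ proves (almost_all (claim D F)) (claim D F k).
Proof.
  intros H. apply (Hcons k), (proves_mp _ (claim D F k)).
  - apply proves_ax. right. now right.
  - apply (proves_cut (almost_all (claim D F))); [apply almost_all_within_all_but|exact H].
Qed.

Lemma sentence_PA A : PA A -> sentence A.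
Proof.
  destruct 1; try (cbn; lia || (cbn; repeat split; lia)). assumption.
Qed.

Lemma sentence_refuting j B : refuting (claim D F) j B -> sentence B.
Proof.
  pose proof (fun l => sentence_claim D F l HB) as HX. unfold sentence in *.
  intros [[[HP|(p & q & _ & ->)]|(l & _ & ->)]|(A & b & m & HA & _ & _ & ->)];
    cbn [bounded Neg]; auto.
  now apply sentence_PA.
Qed.

Lemma def1_almost_all f : Fun1 f -> Def1 (fun r => codes (almost_all (claim D F)) (f r)).
Proof.
  apply def1_rel1.
  apply (def1_ext (fun r => codes PA (r 0) \/ exists p q, p <> q /\
    r 0 = cimp (cneg (claim_code D (code F) p)) (claim_code D (code F) q))).
  - apply def1_or; [apply def1_PA; def1|]. def1; apply fun1_claim_code; def1.
  - intros r. split.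
    + intros [(B & HP & <-)|(p & q & Hpq & E)]; [exists B; split; [now left|reflexivity]|].
      rewrite <- !code_claim in E. eexists. split; [right; eauto|]. now rewrite E.
    + intros (B & [HP|(p & q & Hpq & ->)] & <-); [left; now exists B|].
      right. exists p, q. cbn [code Neg]. rewrite !code_claim. auto.
Qed.

Lemma def1_refuting :
  Def1 (fun r => codes (refuting (claim D F) (r 0)) (r 1)).
Proof.
  apply (def1_ext (fun r => codes (almost_all (claim D F)) (r 1) \/
    (exists l, 2 + r 0 <= l /\ r 1 = claim_code D (code F) l) \/
    exists a b m, Bounded 0 a /\ b <= 1 /\ r 0 = to_nat (to_nat (a, b), m) /\
      r 1 = cimp a (cneg (claim_code D (code F) b)))).
  - apply def1_or; [apply def1_almost_all; def1|].
    apply def1_or; def1_syntax; apply fun1_claim_code; def1.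
  - intros r. split.
    + intros [(B & HB' & <-)|[(l & Hl & E)|(a & b & m & (A & HA & ->) & Hb & Hj & E)]].
      * exists B. split; [left; now left|reflexivity].
      * rewrite <- code_claim in E. eexists. split; [left; right; eauto|]. now rewrite E.
      * rewrite <- code_claim in E. exists (Imp A (Neg (claim D F b))).
        split; [|symmetry; exact E]. right. exists A, b, m. auto.
    + intros (B & [[HB'|(l & Hl & ->)]|(A & b & m & HA & Hb & Hj & ->)] & <-).
      * left. now exists B.
      * right. left. exists l. rewrite code_claim. auto.
      * right. right. exists (code A), b, m. cbn [code Neg]. rewrite code_claim.
        split; [now exists A|auto].
Qed.

Lemma theory_refuting j : theory (refuting (claim D F) j).
Proof.
  split; [apply sentence_refuting|]. split; [|split].
  - apply def1_re_set.
    apply (def1_rel2 (fun i x => codes (refuting (claim D F) i) x) (fun _ => j)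
             (fun r => r 0) def1_refuting); def1.
  - intros A. apply proves_cut. intros B H. apply proves_ax. left. left. now left.
  - intros H. destruct (refuting_within_all_but j) as [k Hk].
    apply (Hcons k). now apply (proves_cut (refuting (claim D F) j)).
Qed.

Lemma theory_almost_all : theory (almost_all (claim D F)).
Proof.
  split; [|split; [|split]].
  - intros A HA. apply (sentence_refuting 0). left. now left.
  - apply def1_re_set, def1_almost_all. def1.
  - intros A. apply proves_cut. intros B H. apply proves_ax. now left.
  - intros H. apply (almost_all_unprovable 0). now apply proves_botE.
Qed.

End Independent.

Theorem corollary6p8 (n : nat) (hn : 1 <= n) (G : side) :
  exists (T : nat -> form -> Prop) (U : form -> Prop),
    re_family T /\ theory U /\
    (forall k : nat,
        exists A : form,
          (forall i : nat, i <= k -> Cons G n (T i) A) /\ ~ Th U A) /\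
    ~ (exists A : form,
          (forall i : nat, Cons G n (T i) A) /\ ~ Th U A).
Proof.
  destruct (independent_claims (dual G)) as (F & HF & HB & Hcons).
  set (X := claim (dual G) F).
  assert (HX : forall l, sentence (X l)) by (intros l; now apply sentence_claim).
  assert (HP : forall l, prenex (dual G) n (X l)) by (intros l; now apply prenex_claim).
  exists (refuting X), (almost_all X).
  split; [split; [now apply theory_refuting|]|split; [|split]].
  - apply def1_uniformly_re, def1_refuting.
  - now apply theory_almost_all.
  - intros k. exists (X (2 + k)). split.
    + intros i Hi. split; [apply HX|]. split; [apply in_class_prenex, HP|].
      intros B _ _ H. apply proves_impI in H. apply (proves_mp _ _ _ H).
      apply proves_ax. left. right. exists (2 + k). split; [lia|reflexivity].
    + intros [_ H]. exact (almost_all_unprovable _ _ Hcons _ H).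
  - intros (A & HA & HU). apply HU. destruct (HA 0) as (HS & _).
    split; [exact HS|]. apply (conservative_almost_all X G n); auto.
    + intros l. replace G with (dual (dual G)) by now destruct G.
      apply in_class_neg, HP.
    + intros j. apply (HA j).
Qed.
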